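(* Let $\vec B\in C^5(\mathbb{R}^2,\mathbb{R}^2)$ satisfy the standing sign conditions listed in the context, let $\alpha\in(0,d/2)$, and let $D_\alpha\subset(0,d/2)\times\mathbb{R}$ be the domain defined in the context. Let $f^0\in C^2(D_\alpha)$ and $P,Q\in C^4((0,\alpha))$. Then there exist families $(u^\varepsilon)_{\varepsilon>0}$ and $(f^\varepsilon)_{\varepsilon>0}$ of functions in $C^2(D_\alpha)$ such that for every $\varepsilon>0$ $$\left\{\begin{array}{ll} -\frac{1}{\varepsilon}\Delta_\parallel u^\varepsilon-\Delta_\perp u^\varepsilon=f^\varepsilon & \text{in } D_\alpha,\\ u^\varepsilon(x_0,L/2)=P(x_0) & \text{for all } x_0\in(0,\alpha),\\ \langle\nabla u^\varepsilon,\vec b\rangle(x_0,L/2)=\partial_y u^\varepsilon(x_0,L/2)=Q(x_0) & \text{for all } x_0\in(0,\alpha), \end{array}\right.$$ with $$\lim_{\varepsilon\to0}u^\varepsilon=u^0\quad\text{and}\quad\lim_{\varepsilon\to0}f^\varepsilon=f^0\quad\text{in } C^0_{loc}(D_\alpha),$$ where $u^0\in C^2(D_\alpha)$ is the unique solution to $$\left\{\begin{array}{ll} \Delta_\parallel u^0=0 & \text{in } D_\alpha,\\ u^0(x_0,L/2)=P(x_0) & \text{for all } x_0\in(0,\alpha),\\ \langle\nabla u^0,\vec b\rangle(x_0,L/2)=\partial_y u^0(x_0,L/2)=Q(x_0) & \text{for all } x_0\in(0,\alpha). \end{array}\right.$$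
   Context: Standing conditions on $\vec B=(B_x,B_y)$: there are constants $\eta,d,L>0$ such that, with $S:=(d/2,L/2)$, for $(x,y)\in(-\eta,d+\eta)\times\mathbb{R}$ one has $\vec B(x,y)=\vec 0$ if and only if $(x,y)=S$, and moreover: $B_x>0$ in $(0,d)\times(-\infty,L/2)$ and $B_x<0$ in $(0,d)\times(L/2,+\infty)$; $B_x<0$ in $(-\eta,0)\times(-\infty,L/2)$ and $B_x>0$ in $(-\eta,0)\times(L/2,+\infty)$; $B_y>0$ in $(-\eta,d/2)\times\mathbb{R}$ and $B_y<0$ in $(d/2,d+\eta)\times\mathbb{R}$; $B_x(0,y)=B_x(d,y)=0$ for all $y\in\mathbb{R}$; $B_y(x,L)>0$ and $B_y(x,0)>0$ for $0\le x<d/2$. The normalized field is $\vec b:=\vec B/\|\vec B\|$ on $((-\eta,d+\eta)\times\mathbb{R})\setminus\{S\}$ (Euclidean norm). The flow $t\mapsto\Phi_t(p)$ is the solution of $\frac{d}{dt}\Phi_t(p)=\vec b(\Phi_t(p))$, $\Phi_0(p)=p$; trajectories starting at $(x_0,L/2)$ with $-\eta/2<x_0<d/2$ are defined for all $t\in\mathbb{R}$. For $\alpha\in(0,d/2)$ write $(x_\alpha(t),y_\alpha(t)):=\Phi_t(\alpha,L/2)$, $t\in\mathbb{R}$; $y_\alpha$ is a $C^1$-diffeomorphism from $\mathbb{R}$ onto an open interval $I\supset[0,L]$. Define $D_\alpha:=\{(x,y)\in(0,d/2)\times I:\ 0<x<x_\alpha(y_\alpha^{-1}(y))\}$. Operators: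 $\Delta_\parallel u:=\nabla\cdot\big((\vec b\otimes\vec b)\nabla u\big)=\nabla\cdot\big((\vec b\cdot\nabla u)\vec b\big)$ and $\Delta_\perp u:=\Delta u-\Delta_\parallel u$. $C^0_{loc}(D_\alpha)$ convergence means uniform convergence on compact subsets of $D_\alpha$. *)

(* Defs.v *)
(* Stdlib reals with Coquelicot *)
From Stdlib Require Import Reals List.
From Coquelicot Require Import Coquelicot.
Open Scope R_scope.

(* [ex_diff_n f k x y]: the iterated partial derivatives of f up to order k
   exist and are continuous at (x,y).  For an open set D, requiring it at every
   point of D is membership in C^k(D); values of f outside D play no role. *)
Definition Ck_on (k : nat) (D : R * R -> Prop) (f : R -> R -> R) : Prop :=
  forall x y, D (x, y) -> ex_diff_n f k x y.

Definition Ck_on_interval (k : nat) (a b : R) (f : R -> R) : Prop :=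
  forall x, a < x < b ->
  forall j, (j <= k)%nat -> ex_derive_n f j x /\ continuous (Derive_n f j) x.

Definition strip (eta d : R) (p : R * R) : Prop :=
  - eta < fst p < d + eta.

Record standing (Bx By : R -> R -> R) (eta d L : R) : Prop := {
  eta_pos : 0 < eta;
  d_pos : 0 < d;
  L_pos : 0 < L;
  zero_iff : forall x y, strip eta d (x, y) ->
    ((Bx x y = 0 /\ By x y = 0) <-> (x, y) = (d / 2, L / 2));
  Bx_mid_below : forall x y, 0 < x < d -> y < L / 2 -> 0 < Bx x y;
  Bx_mid_above : forall x y, 0 < x < d -> L / 2 < y -> Bx x y < 0;
  Bx_left_below : forall x y, - eta < x < 0 -> y < L / 2 -> Bx x y < 0;
  Bx_left_above : forall x y, - eta < x < 0 -> L / 2 < y -> 0 < Bx x y;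
  By_left : forall x y, - eta < x < d / 2 -> 0 < By x y;
  By_right : forall x y, d / 2 < x < d + eta -> By x y < 0;
  Bx_walls : forall y, Bx 0 y = 0 /\ Bx d y = 0;
  By_ends : forall x, 0 <= x < d / 2 -> 0 < By x L /\ 0 < By x 0
}.

Definition normB (Bx By : R -> R -> R) (x y : R) : R :=
  sqrt (Bx x y ^ 2 + By x y ^ 2).

(* Components of b = B / |B|; only meaningful where B does not vanish. *)
Definition bx (Bx By : R -> R -> R) (x y : R) : R := Bx x y / normB Bx By x y.
Definition by_ (Bx By : R -> R -> R) (x y : R) : R := By x y / normB Bx By x y.

(* [Phi t p] is the flow of b, specified on the trajectories issued from
   (x0, L/2) with -eta/2 < x0 < d/2, which are global in time. *)
Definition is_flow (Bx By : R -> R -> R) (eta d L : R)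
    (Phi : R -> R * R -> R * R) : Prop :=
  forall x0, - eta / 2 < x0 < d / 2 ->
    let p := (x0, L / 2) in
    Phi 0 p = p /\
    forall t,
      strip eta d (Phi t p) /\ Phi t p <> (d / 2, L / 2) /\
      is_derive (fun s => fst (Phi s p)) t
        (bx Bx By (fst (Phi t p)) (snd (Phi t p))) /\
      is_derive (fun s => snd (Phi s p)) t
        (by_ Bx By (fst (Phi t p)) (snd (Phi t p))).

(* With (x_a, y_a) the trajectory through (alpha, L/2) and I the range of y_a:
   y belongs to I and x < x_a (y_a^-1 y) means y = y_a t, x < x_a t for some
   (necessarily unique, y_a being injective) time t. *)
Definition D_alpha (d L : R) (Phi : R -> R * R -> R * R) (alpha : R)
    (p : R * R) : Prop :=
  0 < fst p < d / 2 /\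
  exists t, snd (Phi t (alpha, L / 2)) = snd p /\
            fst p < fst (Phi t (alpha, L / 2)).

Definition dx (u : R -> R -> R) (x y : R) : R := Derive (fun s => u s y) x.
Definition dy (u : R -> R -> R) (x y : R) : R := Derive (fun s => u x s) y.

Definition grad_par (Bx By : R -> R -> R) (u : R -> R -> R) (x y : R) : R :=
  dx u x y * bx Bx By x y + dy u x y * by_ Bx By x y.

Definition Lap (u : R -> R -> R) (x y : R) : R :=
  dx (dx u) x y + dy (dy u) x y.

Definition Lap_par (Bx By : R -> R -> R) (u : R -> R -> R) (x y : R) : R :=
  dx (fun x' y' => grad_par Bx By u x' y' * bx Bx By x' y') x y +
  dy (fun x' y' => grad_par Bx By u x' y' * by_ Bx By x' y') x y.

Definition Lap_perp (Bx By : R -> R -> R) (u : R -> R -> R) (x y : R) : R :=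
  Lap u x y - Lap_par Bx By u x y.

Definition Cauchy_data (Bx By : R -> R -> R) (L alpha : R) (P Q : R -> R)
    (u : R -> R -> R) : Prop :=
  forall x0, 0 < x0 < alpha ->
    u x0 (L / 2) = P x0 /\
    grad_par Bx By u x0 (L / 2) = dy u x0 (L / 2) /\
    dy u x0 (L / 2) = Q x0.

Definition limit_problem (Bx By : R -> R -> R) (L alpha : R)
    (D : R * R -> Prop) (P Q : R -> R) (u : R -> R -> R) : Prop :=
  (forall x y, D (x, y) -> Lap_par Bx By u x y = 0) /\
  Cauchy_data Bx By L alpha P Q u.

Definition eps_problem (Bx By : R -> R -> R) (L alpha : R)
    (D : R * R -> Prop) (P Q : R -> R) (eps : R) (f u : R -> R -> R) : Prop :=
  (forall x y, D (x, y) ->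
     - (1 / eps) * Lap_par Bx By u x y - Lap_perp Bx By u x y = f x y) /\
  Cauchy_data Bx By L alpha P Q u.

Definition compact_set {T : UniformSpace} (K : T -> Prop) : Prop :=
  forall F : (T -> Prop) -> Prop,
    (forall U, F U -> open U) ->
    (forall x, K x -> exists U, F U /\ U x) ->
    exists l : list (T -> Prop),
      (forall U, In U l -> F U) /\
      (forall x, K x -> exists U, In U l /\ U x).

(* g eps -> g0 as eps -> 0+, uniformly on every compact subset of D *)
Definition cv_C0loc (D : R * R -> Prop) (g : R -> R -> R -> R)
    (g0 : R -> R -> R) : Prop :=
  forall K : R * R -> Prop, compact_set K -> (forall p, K p -> D p) ->
  forall delta : posreal,
    at_right 0 (fun eps =>
      forall x y, K (x, y) -> Rabs (g eps x y - g0 x y) < delta).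

(* Main.v *)
(* On x < d/2 one has By > 0, so the trajectories are graphs x = X(s, y) over the
   y-axis, solving the scalar equation dX/dy = g(X, y) with g = Bx / By and
   X(s, L/2) = s.  Since |b| = 1 and x is monotone on each side of L/2, every
   trajectory reaches all y; hence (s, y) |-> (X(s, y), y) maps (0, alpha) x R onto
   D_alpha.  For a scalar equation dX/ds = exp (int dg/dx (X, .)), which bootstraps
   to X in C^5, and so does its inverse, the label psi with X(psi(x, y), y) = x.

   As b is proportional to (- d_y psi, d_x psi), in the coordinates (s, y) the
   equation Lap_par u = h becomes d_y (m d_y U) = h d_s X with m = by^2 d_s X, which
   two integrations solve uniquely from the Cauchy data.

   For the families take u^eps = u^0 + eps w_n with Lap_par w_n = - h_n and zero
   Cauchy data, where the C^4 functions h_n approximate f^0 + Lap_perp u^0 on an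
   exhausting sequence of boxes, and let f^eps be what the equation prescribes.
   Then f^eps - f^0 = (h_n - f^0 - Lap_perp u^0) - eps Lap_perp w_n tends to 0
   provided that n = n(eps) tends to infinity slowly enough.  The smoothing is needed
   because f^eps must be C^2 while f^0 is only C^2. *)
Require Import Defs.
From Stdlib Require Import Reals List Lra Lia ssreflect.
From Stdlib Require Import ClassicalEpsilon FunctionalExtensionality PropExtensionality.
From Coquelicot Require Import Coquelicot.
Open Scope R_scope.

(** * Functions of class C^k of two variables *)

(** The trajectories are given by [Phi], so no existence theorem for differential equations is
    proved; what has to be built is smooth dependence on the starting abscissa [s]. Everything rests
    on one two-sided Lipschitz estimate in [s]: the upper bound makes [X] continuous, the lower
    bound keeps trajectories from meeting and makes the label continuous. The derivatives follow
    from these two facts. The orders of differentiability balance exactly. The slope is C^5, but d_s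
    X involves [dx g] and is only C^4. With C^4 data, u^0 and the w_n are therefore C^4, and the
    second-order operators leave f^eps in C^2. Boundedness and approximation are carried out in the
    coordinates (s, y). There the exhausting sets are rectangles, while in the plane they have
    curved sides, and the coordinate [s] stays at a positive distance from the ends of (0,
    alpha). *)

Lemma open_locally_2d (D : R * R -> Prop) (x y : R) :
  open D -> D (x, y) -> locally_2d (fun u v => D (u, v)) x y.
Proof.
  intros oD Dxy. apply locally_2d_locally.
  apply: filter_imp (oD _ Dxy). by intros [u v].
Qed.

Lemma Ck_on_le (j k : nat) (D : R * R -> Prop) (f : R -> R -> R) :
  (j <= k)%nat -> Ck_on k D f -> Ck_on j D f.
Proof. intros H Hf x y Dxy. exact (ex_diff_n_m _ _ H _ _ _ (Hf x y Dxy)). Qed.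

Lemma Ck_on_sub (k : nat) (D E : R * R -> Prop) (f : R -> R -> R) :
  (forall p, D p -> E p) -> Ck_on k E f -> Ck_on k D f.
Proof. intros H Hf x y Dxy. apply Hf, H, Dxy. Qed.

Lemma Ck_on_continuity (k : nat) (D : R * R -> Prop) (f : R -> R -> R) (x y : R) :
  Ck_on k D f -> D (x, y) -> continuity_2d_pt f x y.
Proof. intros Hf Dxy. destruct k; apply Hf; exact Dxy. Qed.

Lemma Ck_on_dx (k : nat) (D : R * R -> Prop) (f : R -> R -> R) :
  Ck_on (S k) D f -> Ck_on k D (dx f).
Proof. intros Hf x y Dxy. apply (Hf x y Dxy). Qed.

Lemma Ck_on_dy (k : nat) (D : R * R -> Prop) (f : R -> R -> R) :
  Ck_on (S k) D f -> Ck_on k D (dy f).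
Proof. intros Hf x y Dxy. apply (Hf x y Dxy). Qed.

Lemma Ck_on_is_dx (k : nat) (D : R * R -> Prop) (f : R -> R -> R) (x y : R) :
  Ck_on (S k) D f -> D (x, y) -> is_derive (fun s => f s y) x (dx f x y).
Proof. intros Hf Dxy. apply Derive_correct. apply (Hf x y Dxy). Qed.

Lemma Ck_on_is_dy (k : nat) (D : R * R -> Prop) (f : R -> R -> R) (x y : R) :
  Ck_on (S k) D f -> D (x, y) -> is_derive (fun s => f x s) y (dy f x y).
Proof. intros Hf Dxy. apply Derive_correct. apply (Hf x y Dxy). Qed.

Lemma Ck_on_ext (k : nat) (D : R * R -> Prop) (f g : R -> R -> R) :
  open D -> (forall x y, D (x, y) -> f x y = g x y) ->
  Ck_on k D f -> Ck_on k D g.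
Proof.
  intros oD Hfg Hf x y Dxy. apply ex_diff_n_ext_loc with f; [|apply Hf, Dxy].
  destruct (open_locally_2d D x y oD Dxy) as [d Hd].
  exists d. intros u v Hu Hv. by apply Hfg, Hd.
Qed.

Lemma dx_ext (D : R * R -> Prop) (f g : R -> R -> R) (x y : R) :
  open D -> (forall x y, D (x, y) -> f x y = g x y) -> D (x, y) ->
  dx f x y = dx g x y.
Proof.
  intros oD Hfg Dxy. apply Derive_ext_loc.
  apply: filter_imp (locally_2d_1d_const_y _ _ _ (open_locally_2d D x y oD Dxy)).
  by intros t; apply Hfg.
Qed.

Lemma dy_ext (D : R * R -> Prop) (f g : R -> R -> R) (x y : R) :
  open D -> (forall x y, D (x, y) -> f x y = g x y) -> D (x, y) ->
  dy f x y = dy g x y.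
Proof.
  intros oD Hfg Dxy. apply Derive_ext_loc.
  apply: filter_imp (locally_2d_1d_const_x _ _ _ (open_locally_2d D x y oD Dxy)).
  by intros t; apply Hfg.
Qed.

(** An increment splits into a horizontal step at height [v] and a vertical step on the line through
    [x]. The mean value theorem and the continuity of [fx] at the point control the first, the
    vertical derivative at the point controls the second. *)
Lemma partials_differentiable (D : R * R -> Prop) (f fx fy : R -> R -> R) (x y : R) :
  open D -> D (x, y) ->
  (forall u v, D (u, v) -> is_derive (fun s => f s v) u (fx u v)) ->
  is_derive (fun s => f x s) y (fy x y) ->
  continuity_2d_pt fx x y ->
  differentiable_pt_lim f x y (fx x y) (fy x y).
Proof.
  intros oD Dxy Hx Hy Hc. apply filterdiff_differentiable_pt_lim.
  apply: is_derive_filterdiff.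
  - apply: filter_imp (oD _ Dxy). intros [u v] Duv. by apply Hx.
  - exact Hy.
  - by apply continuity_2d_pt_filterlim.
Qed.

(** Introduction rule behind the C^k proofs: explicit candidates for the partial derivatives are
    easier to handle than [Derive]. The continuity of [f] demanded by [ex_diff_n] comes from
    differentiability. *)
Lemma Ck_on_S (k : nat) (D : R * R -> Prop) (f fx fy : R -> R -> R) :
  open D ->
  (forall x y, D (x, y) -> is_derive (fun s => f s y) x (fx x y)) ->
  (forall x y, D (x, y) -> is_derive (fun s => f x s) y (fy x y)) ->
  Ck_on k D fx -> Ck_on k D fy -> Ck_on (S k) D f.
Proof.
  intros oD Hx Hy Cx Cy.
  assert (Cdx : Ck_on k D (dx f)).
  { apply Ck_on_ext with fx; [easy| |easy]. intros x y Dxy.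
    symmetry. apply is_derive_unique, Hx, Dxy. }
  assert (Cdy : Ck_on k D (dy f)).
  { apply Ck_on_ext with fy; [easy| |easy]. intros x y Dxy.
    symmetry. apply is_derive_unique, Hy, Dxy. }
  intros x y Dxy. split; [|split; [|split; [|split]]].
  - apply differentiable_continuity_pt. exists (fx x y), (fy x y).
    apply (partials_differentiable D); auto.
    by apply (Ck_on_continuity k D).
  - exists (fx x y). by apply Hx.
  - exists (fy x y). by apply Hy.
  - by apply Cdx.
  - by apply Cdy.
Qed.

Lemma Ck_on_differentiable (k : nat) (D : R * R -> Prop) (f : R -> R -> R) (x y : R) :
  open D -> Ck_on (S k) D f -> D (x, y) ->
  differentiable_pt_lim f x y (dx f x y) (dy f x y).
Proof.
  intros oD Hf Dxy. apply (partials_differentiable D); auto.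
  - intros u v Duv. by apply (Ck_on_is_dx k D).
  - by apply (Ck_on_is_dy k D).
  - apply (Ck_on_continuity k D); auto. by apply Ck_on_dx.
Qed.

Lemma Ck_on_const (k : nat) (D : R * R -> Prop) (c : R) :
  open D -> Ck_on k D (fun _ _ => c).
Proof.
  intros oD. revert c. induction k as [|k IH]; intros c.
  - intros x y _. split; [apply continuity_2d_pt_const|easy].
  - apply (Ck_on_S k D _ (fun _ _ => 0) (fun _ _ => 0)); auto;
      intros x y _; apply: is_derive_const.
Qed.

Lemma Ck_on_fst (k : nat) (D : R * R -> Prop) :
  open D -> Ck_on k D (fun x _ => x).
Proof.
  intros oD. destruct k as [|k].
  - intros x y _. split; [apply continuity_2d_pt_id1|easy].
  - apply (Ck_on_S k D _ (fun _ _ => 1) (fun _ _ => 0));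
      auto using Ck_on_const; intros x y _;
      [apply: is_derive_id|apply: is_derive_const].
Qed.

Lemma Ck_on_snd (k : nat) (D : R * R -> Prop) :
  open D -> Ck_on k D (fun _ y => y).
Proof.
  intros oD. destruct k as [|k].
  - intros x y _. split; [apply continuity_2d_pt_id2|easy].
  - apply (Ck_on_S k D _ (fun _ _ => 0) (fun _ _ => 1));
      auto using Ck_on_const; intros x y _;
      [apply: is_derive_const|apply: is_derive_id].
Qed.

Lemma Ck_on_plus (k : nat) (D : R * R -> Prop) (f g : R -> R -> R) :
  open D -> Ck_on k D f -> Ck_on k D g -> Ck_on k D (fun x y => f x y + g x y).
Proof.
  intros oD. revert f g. induction k as [|k IH]; intros f g Hf Hg.
  - intros x y Dxy. split; [|easy].
    apply continuity_2d_pt_plus; [apply Hf|apply Hg]; easy.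
  - apply (Ck_on_S k D _ (fun x y => dx f x y + dx g x y)
                         (fun x y => dy f x y + dy g x y)); auto.
    + intros x y Dxy. apply: is_derive_plus; by apply (Ck_on_is_dx k D).
    + intros x y Dxy. apply: is_derive_plus; by apply (Ck_on_is_dy k D).
    + apply IH; by apply Ck_on_dx.
    + apply IH; by apply Ck_on_dy.
Qed.

Lemma Ck_on_mult (k : nat) (D : R * R -> Prop) (f g : R -> R -> R) :
  open D -> Ck_on k D f -> Ck_on k D g -> Ck_on k D (fun x y => f x y * g x y).
Proof.
  intros oD. revert f g. induction k as [|k IH]; intros f g Hf Hg.
  - intros x y Dxy. split; [|easy].
    apply continuity_2d_pt_mult; [apply Hf|apply Hg]; easy.
  - assert (Hf' := Ck_on_le k _ D f (Nat.le_succ_diag_r k) Hf).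
    assert (Hg' := Ck_on_le k _ D g (Nat.le_succ_diag_r k) Hg).
    apply (Ck_on_S k D _ (fun x y => dx f x y * g x y + f x y * dx g x y)
                         (fun x y => dy f x y * g x y + f x y * dy g x y)); auto.
    + intros x y Dxy. apply: is_derive_mult; try (by apply (Ck_on_is_dx k D)).
      exact Rmult_comm.
    + intros x y Dxy. apply: is_derive_mult; try (by apply (Ck_on_is_dy k D)).
      exact Rmult_comm.
    + apply Ck_on_plus; auto; apply IH; auto; by apply Ck_on_dx.
    + apply Ck_on_plus; auto; apply IH; auto; by apply Ck_on_dy.
Qed.

Lemma Ck_on_opp (k : nat) (D : R * R -> Prop) (f : R -> R -> R) :
  open D -> Ck_on k D f -> Ck_on k D (fun x y => - f x y).
Proof.
  intros oD Hf. apply (Ck_on_ext k D (fun x y => -1 * f x y)); auto.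
  - intros; ring.
  - by apply Ck_on_mult; [|apply Ck_on_const|].
Qed.

Lemma Ck_on_minus (k : nat) (D : R * R -> Prop) (f g : R -> R -> R) :
  open D -> Ck_on k D f -> Ck_on k D g -> Ck_on k D (fun x y => f x y - g x y).
Proof.
  intros oD Hf Hg. apply Ck_on_plus; auto. by apply Ck_on_opp.
Qed.

Lemma Ck_on_inv (k : nat) (D : R * R -> Prop) (f : R -> R -> R) :
  open D -> (forall x y, D (x, y) -> f x y <> 0) ->
  Ck_on k D f -> Ck_on k D (fun x y => / f x y).
Proof.
  intros oD Hnz. induction k as [|k IH]; intros Hf.
  - intros x y Dxy. split; [|easy].
    apply continuity_2d_pt_inv; [apply Hf|]; auto.
  - assert (Hi := IH (Ck_on_le k _ D f (Nat.le_succ_diag_r k) Hf)).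
    apply (Ck_on_S k D _ (fun x y => - dx f x y * (/ f x y * / f x y))
                         (fun x y => - dy f x y * (/ f x y * / f x y))); auto.
    + intros x y Dxy.
      replace (- dx f x y * (/ f x y * / f x y)) with (- dx f x y / f x y ^ 2)
        by (field; auto).
      apply: is_derive_inv; [by apply (Ck_on_is_dx k D)|auto].
    + intros x y Dxy.
      replace (- dy f x y * (/ f x y * / f x y)) with (- dy f x y / f x y ^ 2)
        by (field; auto).
      apply: is_derive_inv; [by apply (Ck_on_is_dy k D)|auto].
    + repeat apply Ck_on_mult; auto. apply Ck_on_opp; auto. by apply Ck_on_dx.
    + repeat apply Ck_on_mult; auto. apply Ck_on_opp; auto. by apply Ck_on_dy.
Qed.

Lemma Ck_on_div (k : nat) (D : R * R -> Prop) (f g : R -> R -> R) :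
  open D -> (forall x y, D (x, y) -> g x y <> 0) ->
  Ck_on k D f -> Ck_on k D g -> Ck_on k D (fun x y => f x y / g x y).
Proof.
  intros oD Hnz Hf Hg. apply Ck_on_mult; auto. by apply Ck_on_inv.
Qed.

Lemma Ck_on_exp (k : nat) (D : R * R -> Prop) (f : R -> R -> R) :
  open D -> Ck_on k D f -> Ck_on k D (fun x y => exp (f x y)).
Proof.
  intros oD. induction k as [|k IH]; intros Hf.
  - intros x y Dxy. split; [|easy]. apply continuity_1d_2d_pt_comp; [|by apply Hf].
    apply derivable_continuous_pt, derivable_pt_exp.
  - assert (Hi := IH (Ck_on_le k _ D f (Nat.le_succ_diag_r k) Hf)).
    apply (Ck_on_S k D _ (fun x y => dx f x y * exp (f x y))
                         (fun x y => dy f x y * exp (f x y))); auto.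
    + intros x y Dxy. apply: (is_derive_comp exp); [apply is_derive_exp|].
      by apply (Ck_on_is_dx k D).
    + intros x y Dxy. apply: (is_derive_comp exp); [apply is_derive_exp|].
      by apply (Ck_on_is_dy k D).
    + apply Ck_on_mult; auto. by apply Ck_on_dx.
    + apply Ck_on_mult; auto. by apply Ck_on_dy.
Qed.

Lemma Ck_on_sqrt (k : nat) (D : R * R -> Prop) (f : R -> R -> R) :
  open D -> (forall x y, D (x, y) -> 0 < f x y) ->
  Ck_on k D f -> Ck_on k D (fun x y => sqrt (f x y)).
Proof.
  intros oD Hpos. induction k as [|k IH]; intros Hf.
  - intros x y Dxy. split; [|easy]. apply continuity_1d_2d_pt_comp; [|by apply Hf].
    apply continuity_pt_sqrt. by apply Rlt_le, Hpos.
  - assert (Hi := IH (Ck_on_le k _ D f (Nat.le_succ_diag_r k) Hf)).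
    assert (Hn : forall x y, D (x, y) -> 2 * sqrt (f x y) <> 0).
    { intros x y Dxy. assert (H := sqrt_lt_R0 _ (Hpos x y Dxy)). lra. }
    apply (Ck_on_S k D _ (fun x y => dx f x y / (2 * sqrt (f x y)))
                         (fun x y => dy f x y / (2 * sqrt (f x y)))); auto.
    + intros x y Dxy. apply: is_derive_sqrt; [|auto].
      by apply (Ck_on_is_dx k D).
    + intros x y Dxy. apply: is_derive_sqrt; [|auto].
      by apply (Ck_on_is_dy k D).
    + apply Ck_on_div; auto. by apply Ck_on_dx.
      apply Ck_on_mult; auto using Ck_on_const.
    + apply Ck_on_div; auto. by apply Ck_on_dy.
      apply Ck_on_mult; auto using Ck_on_const.
Qed.

Lemma continuity_2d_pt_comp (f p q : R -> R -> R) (x y : R) :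
  continuity_2d_pt f (p x y) (q x y) -> continuity_2d_pt p x y ->
  continuity_2d_pt q x y -> continuity_2d_pt (fun u v => f (p u v) (q u v)) x y.
Proof.
  intros Hf Hp Hq. apply continuity_2d_pt_filterlim.
  apply (continuous_comp_2 (fun z : R * R => p (fst z) (snd z))
    (fun z : R * R => q (fst z) (snd z)) f (x, y));
    by apply continuity_2d_pt_filterlim.
Qed.

Lemma is_derive_comp_2d (f : R -> R -> R) (p q : R -> R) (x fx fy dp dq : R) :
  differentiable_pt_lim f (p x) (q x) fx fy ->
  is_derive p x dp -> is_derive q x dq ->
  is_derive (fun t => f (p t) (q t)) x (fx * dp + fy * dq).
Proof.
  intros Hf Hp Hq. apply is_derive_Reals.
  apply derivable_pt_lim_comp_2d; auto; by apply is_derive_Reals.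
Qed.

(** The chain rule produces [dx f] and [dy f] composed with the same inner maps, so the induction on
    [k] runs over all [f] at once. *)
Lemma Ck_on_comp (k : nat) (D E : R * R -> Prop) (f p q : R -> R -> R) :
  open D -> open E -> (forall x y, D (x, y) -> E (p x y, q x y)) ->
  Ck_on k E f -> Ck_on k D p -> Ck_on k D q ->
  Ck_on k D (fun x y => f (p x y) (q x y)).
Proof.
  intros oD oE Hpq. revert f. induction k as [|k IH]; intros f Hf Hp Hq.
  - intros x y Dxy. split; [|easy]. apply continuity_2d_pt_comp.
    + by apply Hf, Hpq.
    + by apply Hp.
    + by apply Hq.
  - assert (Hp' := Ck_on_le k _ D p (Nat.le_succ_diag_r k) Hp).
    assert (Hq' := Ck_on_le k _ D q (Nat.le_succ_diag_r k) Hq).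
    apply (Ck_on_S k D _
      (fun x y => dx f (p x y) (q x y) * dx p x y + dy f (p x y) (q x y) * dx q x y)
      (fun x y => dx f (p x y) (q x y) * dy p x y + dy f (p x y) (q x y) * dy q x y));
      auto.
    + intros x y Dxy.
      apply (is_derive_comp_2d f (fun s => p s y) (fun s => q s y)).
      * by apply (Ck_on_differentiable k E); auto.
      * by apply (Ck_on_is_dx k D).
      * by apply (Ck_on_is_dx k D).
    + intros x y Dxy.
      apply (is_derive_comp_2d f (fun s => p x s) (fun s => q x s)).
      * by apply (Ck_on_differentiable k E); auto.
      * by apply (Ck_on_is_dy k D).
      * by apply (Ck_on_is_dy k D).
    + apply Ck_on_plus; auto; apply Ck_on_mult; auto using Ck_on_dx, Ck_on_dy.
    + apply Ck_on_plus; auto; apply Ck_on_mult; auto using Ck_on_dx, Ck_on_dy.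
Qed.

(** A union of full vertical lines: integration in the second variable from any base point to any
    height stays inside. *)
Definition vstrip (J : R -> Prop) (p : R * R) : Prop := J (fst p).

Lemma open_vstrip (J : R -> Prop) : open J -> open (vstrip J).
Proof.
  intros oJ. apply (open_comp fst J); [|easy]. intros [x y] _. apply: continuous_fst.
Qed.

Lemma Ck_on_interval_vstrip (k : nat) (a b : R) (P : R -> R) :
  Ck_on_interval k a b P ->
  Ck_on k (vstrip (fun x => a < x < b)) (fun x _ => P x).
Proof.
  assert (oV : open (vstrip (fun x => a < x < b))).
  { apply open_vstrip. apply: open_and; [apply open_gt|apply open_lt]. }
  revert P. induction k as [|k IH]; intros P HP.
  - intros x y Hx. split; [|easy].
    apply (continuity_1d_2d_pt_comp P (fun u _ => u)).
    + apply continuity_pt_filterlim. apply (HP x Hx 0%nat). lia.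
    + apply continuity_2d_pt_id1.
  - apply (Ck_on_S k _ _ (fun x _ => Derive P x) (fun _ _ => 0)); auto.
    + intros x y Hx. apply Derive_correct. apply (HP x Hx 1%nat). lia.
    + intros x y _. apply: is_derive_const.
    + apply IH. intros x Hx j Hj.
      destruct (HP x Hx (S j)) as [H1 H2]; [lia|].
      assert (Hn : forall i t, Derive_n (Derive P) i t = Derive_n P (S i) t).
      { intros i t. rewrite (Derive_n_comp P i 1). f_equal. lia. }
      split.
      * destruct j as [|j]; [easy|]. simpl.
        apply: ex_derive_ext H1. intros t. by rewrite Hn.
      * apply: continuous_ext H2. intros t. by rewrite Hn.
    + apply Ck_on_const, oV.
Qed.

(** * Integrals in the second variable, with the first as parameter *)

Lemma abs_RInt_le_bound (f : R -> R) (a b M : R) :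
  ex_RInt f a b ->
  (forall t, Rmin a b <= t <= Rmax a b -> Rabs (f t) <= M) ->
  Rabs (RInt f a b) <= Rabs (b - a) * M.
Proof.
  intros Hf HM. destruct (Rle_dec a b) as [Hab|Hab].
  - rewrite (Rmin_left _ _ Hab) (Rmax_right _ _ Hab) in HM.
    rewrite (Rabs_pos_eq (b - a)); [|lra]. by apply abs_RInt_le_const.
  - assert (Hba : b <= a) by lra.
    rewrite (Rmin_right _ _ Hba) (Rmax_left _ _ Hba) in HM.
    rewrite Rabs_minus_sym (Rabs_pos_eq (a - b)); [|lra].
    rewrite <- (opp_RInt_swap f b a (ex_RInt_swap _ _ _ Hf)).
    change (opp ?u) with (- u). rewrite Rabs_Ropp.
    apply abs_RInt_le_const; [lra|by apply ex_RInt_swap|auto].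
Qed.

Lemma continuity_2d_pt_section (f : R -> R -> R) (x y : R) :
  continuity_2d_pt f x y -> continuous (f x) y.
Proof.
  intros H. apply continuity_2d_pt_filterlim in H.
  apply (continuous_comp_2 (fun _ : R => x) (fun t : R => t) f y).
  - apply continuous_const.
  - apply continuous_id.
  - exact H.
Qed.

Lemma strip_ex_RInt (J : R -> Prop) (f : R -> R -> R) (x a b : R) :
  Ck_on 0 (vstrip J) f -> J x -> ex_RInt (f x) a b.
Proof.
  intros Hf Jx. apply: ex_RInt_continuous. intros t _.
  apply continuity_2d_pt_section. by apply Hf.
Qed.

Lemma is_derive_RInt_upper (J : R -> Prop) (f : R -> R -> R) (c x y : R) :
  Ck_on 0 (vstrip J) f -> J x -> is_derive (fun t => RInt (f x) c t) y (f x y).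
Proof.
  intros Hf Jx. apply: (is_derive_RInt (f x) (fun t => RInt (f x) c t) c y).
  - apply filter_forall. intros t. apply: RInt_correct. by apply (strip_ex_RInt J).
  - apply continuity_2d_pt_section. by apply Hf.
Qed.

Lemma RInt_param_continuity (J : R -> Prop) (f : R -> R -> R) (c x y : R) :
  open J -> Ck_on 0 (vstrip J) f -> J x ->
  continuity_2d_pt (fun u v => RInt (f u) c v) x y.
Proof.
  intros oJ Hf Jx eps.
  destruct (oJ x Jx) as [r Hr].
  (* The margin 1 makes the box contain every integration interval from [c] to [v] with
     [|v - y| < 1], and keeps [hi - lo] positive. *)
  set (lo := Rmin c y - 1). set (hi := Rmax c y + 1).
  assert (He : 0 < eps / 2 / (hi - lo)).
  { apply Rdiv_lt_0_compat; [apply is_pos_div_2|]. unfold lo, hi.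
    assert (H := Rmin_l c y). assert (H' := Rmax_l c y). lra. }
  assert (HJ : forall u, x - r / 2 <= u <= x + r / 2 -> J u).
  { intros u Hu. apply Hr. apply Rabs_lt_between'. assert (H := cond_pos r). lra. }
  destruct (uniform_continuity_2d f (x - r / 2) (x + r / 2) lo hi) with (mkposreal _ He)
    as [d1 Hd1].
  { intros u v Hu _. apply Hf. by apply HJ. }
  assert (Hc : continuous (fun t => RInt (f x) c t) y).
  { apply: ex_derive_continuous. exists (f x y). by apply (is_derive_RInt_upper J). }
  destruct (proj1 (filterlim_locally _ _) Hc (pos_div_2 eps)) as [d2 Hd2].
  assert (Hd : 0 < Rmin (Rmin d1 (r / 2)) (Rmin d2 1)).
  { repeat apply Rmin_glb_lt; try apply cond_pos; try lra. apply is_pos_div_2. }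
  exists (mkposreal _ Hd). simpl. intros u v Hu Hv.
  assert (H1 := Rmin_l (Rmin d1 (r / 2)) (Rmin d2 1)).
  assert (H2 := Rmin_r (Rmin d1 (r / 2)) (Rmin d2 1)).
  assert (H3 := Rmin_l d1 (r / 2)). assert (H4 := Rmin_r d1 (r / 2)).
  assert (H5 := Rmin_l d2 1). assert (H6 := Rmin_r d2 1).
  assert (Hr2 := cond_pos r).
  assert (Hu' : x - r / 2 <= u <= x + r / 2).
  { apply Rabs_le_between'. lra. }
  assert (Hvb : y - 1 < v < y + 1) by (apply Rabs_lt_between'; lra).
  assert (Hcv : lo <= Rmin c v /\ Rmax c v <= hi).
  { unfold lo, hi, Rmin, Rmax. repeat destruct Rle_dec; lra. }
  assert (Ev := Hd2 v). specialize (Ev ltac:(apply: (Rlt_le_trans _ _ _ Hv); lra)).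
  change (Rabs (RInt (f x) c v - RInt (f x) c y) < eps / 2) in Ev.
  assert (Eu : Rabs (RInt (f u) c v - RInt (f x) c v) <= eps / 2).
  { assert (E := RInt_minus (f u) (f x) c v (strip_ex_RInt J f u c v Hf (HJ u Hu'))
      (strip_ex_RInt J f x c v Hf Jx)).
    change (minus ?p ?q) with (p - q) in E. rewrite <- E.
    apply Rle_trans with (Rabs (v - c) * (eps / 2 / (hi - lo))).
    - apply abs_RInt_le_bound.
      + apply: ex_RInt_minus; apply (strip_ex_RInt J); auto.
      + intros t Ht. left. apply Hd1; simpl; try lra.
        rewrite Rminus_eq_0 Rabs_R0. apply cond_pos.
    - assert (Hl : Rabs (v - c) <= hi - lo).
      { apply Rabs_le. unfold Rmin, Rmax in Hcv. repeat destruct Rle_dec in Hcv; lra. }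
      assert (0 < hi - lo). { unfold lo, hi, Rmin, Rmax. repeat destruct Rle_dec; lra. }
      apply Rle_trans with ((hi - lo) * (eps / 2 / (hi - lo))).
      + apply Rmult_le_compat_r; lra.
      + right. field. lra. }
  replace (RInt (f u) c v - RInt (f x) c y) with
    ((RInt (f u) c v - RInt (f x) c v) + (RInt (f x) c v - RInt (f x) c y)) by ring.
  eapply Rle_lt_trans; [apply Rabs_triang|]. lra.
Qed.

Lemma is_derive_RInt_strip (J : R -> Prop) (f fx : R -> R -> R) (c x y : R) :
  open J -> Ck_on 0 (vstrip J) f -> Ck_on 0 (vstrip J) fx ->
  (forall u v, J u -> is_derive (fun s => f s v) u (fx u v)) -> J x ->
  is_derive (fun u => RInt (f u) c y) x (RInt (fx x) c y).
Proof.
  intros oJ Hf Hfx Hd Jx.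
  rewrite <- (RInt_ext (dx f x)).
  2: { intros t _. by apply is_derive_unique, Hd. }
  assert (Hdx : Ck_on 0 (vstrip J) (dx f)).
  { apply Ck_on_ext with fx; auto. by apply open_vstrip.
    intros u v Ju. symmetry. by apply is_derive_unique, Hd. }
  apply: (is_derive_RInt_param f c y x).
  - apply: filter_imp (oJ x Jx). intros u Ju t _. exists (fx u t). by apply Hd.
  - intros t _. by apply (Ck_on_continuity 0 (vstrip J) (dx f)).
  - apply: filter_imp (oJ x Jx). intros u Ju. by apply (strip_ex_RInt J).
Qed.

(** The x-partial is an integral of the same kind, with [dx f] as integrand, so the induction
    hypothesis applies; the y-partial is [f] itself. *)
Lemma Ck_on_RInt (k : nat) (J : R -> Prop) (f : R -> R -> R) (c : R) :
  open J -> Ck_on k (vstrip J) f -> Ck_on k (vstrip J) (fun x y => RInt (f x) c y).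
Proof.
  intros oJ. revert f. induction k as [|k IH]; intros f Hf.
  - intros x y Jx. split; [|easy]. by apply (RInt_param_continuity J).
  - apply (Ck_on_S k _ _ (fun x y => RInt (dx f x) c y) f).
    + by apply open_vstrip.
    + intros x y Jx. apply (is_derive_RInt_strip J); auto.
      * apply (Ck_on_le 0 (S k)); auto. lia.
      * apply (Ck_on_le 0 k); [lia|]. by apply Ck_on_dx.
      * intros u v Ju. by apply (Ck_on_is_dx k (vstrip J)).
    + intros x y Jx. apply (is_derive_RInt_upper J); auto.
      apply (Ck_on_le 0 (S k)); auto. lia.
    + apply IH. by apply Ck_on_dx.
    + apply (Ck_on_le k (S k)); auto.
Qed.

(** * Smoothing by averages *)

(** The Steklov mean of [f x] over [[y, y + r]], written as a difference of primitives with the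
    fixed base point 0 so that [Ck_on_RInt] applies. *)
Definition avg_y (r : R) (f : R -> R -> R) (x y : R) : R :=
  (RInt (f x) 0 (y + r) - RInt (f x) 0 y) / r.

Definition avg_x (r : R) (f : R -> R -> R) (x y : R) : R :=
  avg_y r (fun u v => f v u) y x.

Notation plane := (vstrip (fun _ => True)).

Lemma open_plane : open plane.
Proof. apply open_vstrip, open_true. Qed.

Lemma Ck_on_swap (k : nat) (f : R -> R -> R) :
  Ck_on k plane f -> Ck_on k plane (fun u v => f v u).
Proof.
  intros Hf. apply (Ck_on_comp k plane plane f (fun _ v => v) (fun u _ => u));
    auto using open_plane, Ck_on_fst, Ck_on_snd.
Qed.

Lemma Ck_on_shift_y (k : nat) (r : R) (f : R -> R -> R) :
  Ck_on k plane f -> Ck_on k plane (fun u v => f u (v + r)).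
Proof.
  intros Hf. assert (oP := open_plane).
  apply (Ck_on_comp k plane plane f (fun u _ => u) (fun _ v => v + r));
    auto using Ck_on_fst.
  apply Ck_on_plus; auto using Ck_on_const, Ck_on_snd.
Qed.

Lemma Ck_on_avg_y (k : nat) (r : R) (f : R -> R -> R) :
  r <> 0 -> Ck_on k plane f -> Ck_on k plane (avg_y r f).
Proof.
  intros Hr Hf. assert (oP := open_plane).
  apply Ck_on_div; auto using Ck_on_const.
  assert (HI := Ck_on_RInt k (fun _ => True) f 0 open_true Hf).
  apply Ck_on_minus; auto.
  by apply (Ck_on_shift_y k r (fun u v => RInt (f u) 0 v)).
Qed.

Lemma Ck_on_avg_x (k : nat) (r : R) (f : R -> R -> R) :
  r <> 0 -> Ck_on k plane f -> Ck_on k plane (avg_x r f).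
Proof.
  intros Hr Hf.
  by apply (Ck_on_swap k (avg_y r (fun u v => f v u))), Ck_on_avg_y, Ck_on_swap.
Qed.

Lemma is_derive_avg_y (r : R) (f : R -> R -> R) (x y : R) :
  Ck_on 0 plane f ->
  is_derive (fun t => avg_y r f x t) y ((f x (y + r) - f x y) / r).
Proof.
  intros Hf.
  assert (HI : forall t, is_derive (fun v => RInt (f x) 0 v) t (f x t)).
  { intros t. by apply (is_derive_RInt_upper (fun _ => True)). }
  unfold avg_y. unfold Rdiv.
  apply: (is_derive_ext (fun t => / r * (RInt (f x) 0 (t + r) - RInt (f x) 0 t))).
  { intros t. apply Rmult_comm. }
  rewrite Rmult_comm. apply: is_derive_scal. apply: is_derive_minus; auto.
  replace (f x (y + r)) with (1 * f x (y + r)) by ring.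
  apply: (is_derive_comp (fun v => RInt (f x) 0 v) (fun t => t + r)); auto.
  replace 1 with (1 + 0) by ring.
  apply: is_derive_plus; [apply: is_derive_id|apply: is_derive_const].
Qed.

Lemma is_derive_avg_x_param (r : R) (f fy : R -> R -> R) (x y : R) :
  Ck_on 0 plane f -> Ck_on 0 plane fy ->
  (forall u v, is_derive (fun s => f u s) v (fy u v)) ->
  is_derive (fun t => avg_x r f x t) y (avg_x r fy x y).
Proof.
  intros Hf Hfy Hd.
  assert (HI : forall c, is_derive (fun u => RInt (fun v => f v u) 0 c) y
                 (RInt (fun v => fy v y) 0 c)).
  { intros c. apply (is_derive_RInt_strip (fun _ => True) (fun u v => f v u)
      (fun u v => fy v u)); auto using open_true, Ck_on_swap. }
  unfold avg_x, avg_y, Rdiv.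
  apply: (is_derive_ext (fun t => / r * (RInt (fun v => f v t) 0 (x + r)
                                         - RInt (fun v => f v t) 0 x))).
  { intros t. apply Rmult_comm. }
  rewrite Rmult_comm. apply: is_derive_scal. by apply: is_derive_minus.
Qed.

(* Each averaging differentiates to a difference quotient in its own variable,
   so averaging in both variables gains one order of regularity. *)
Lemma Ck_on_avg (k : nat) (r : R) (f : R -> R -> R) :
  r <> 0 -> Ck_on k plane f -> Ck_on (S k) plane (avg_x r (avg_y r f)).
Proof.
  intros Hr Hf. assert (oP := open_plane).
  assert (Hg := Ck_on_avg_y k r f Hr Hf).
  assert (Hdiff : forall h, Ck_on k plane h ->
            Ck_on k plane (fun u v => (h u (v + r) - h u v) / r)).
  { intros h Hh. apply Ck_on_div; auto using Ck_on_const.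
    apply Ck_on_minus; auto. by apply Ck_on_shift_y. }
  apply (Ck_on_S k _ _
    (fun x y => (avg_y r f (x + r) y - avg_y r f x y) / r)
    (avg_x r (fun x y => (f x (y + r) - f x y) / r))); auto.
  - intros x y _.
    apply (is_derive_avg_y r (fun u v => avg_y r f v u) y x).
    apply Ck_on_swap, Ck_on_avg_y; auto. by apply (Ck_on_le 0 k); [lia|].
  - intros x y _. apply is_derive_avg_x_param.
    + apply (Ck_on_le 0 k); auto. lia.
    + apply (Ck_on_le 0 k); auto. lia.
    + intros u v. apply is_derive_avg_y. apply (Ck_on_le 0 k); auto. lia.
  - apply (Ck_on_swap k (fun u v => (avg_y r f (v + r) u - avg_y r f v u) / r)).
    apply (Hdiff (fun u v => avg_y r f v u)). by apply Ck_on_swap.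
  - apply Ck_on_avg_x; auto.
Qed.

(** The reference value [c] is arbitrary, so that the estimate can be nested: both the inner and the
    outer mean are compared with the same number. *)
Lemma avg_y_close (r e c : R) (f : R -> R -> R) (x y : R) :
  0 < r -> Ck_on 0 plane f ->
  (forall t, y <= t <= y + r -> Rabs (f x t - c) <= e) ->
  Rabs (avg_y r f x y - c) <= e.
Proof.
  intros Hr Hf He.
  assert (HI : forall a b, ex_RInt (f x) a b).
  { intros a b. by apply (strip_ex_RInt (fun _ => True)). }
  assert (HC := RInt_Chasles (f x) 0 y (y + r) (HI _ _) (HI _ _)).
  change (plus ?p ?q) with (p + q) in HC.
  assert (HM := RInt_minus (f x) (fun _ => c) y (y + r) (HI _ _) (ex_RInt_const _ _ _)).
  rewrite RInt_const in HM. change (minus ?p ?q) with (p - q) in HM.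
  change (scal ?p ?q) with (p * q) in HM.
  replace (avg_y r f x y - c) with (RInt (fun t => f x t - c) y (y + r) / r).
  2: { change (fun t => f x t - c) with (fun t => minus (f x t) c).
       rewrite HM. unfold avg_y. rewrite <- HC. field. lra. }
  unfold Rdiv. rewrite Rabs_mult (Rabs_pos_eq (/ r)).
  2: { left. by apply Rinv_0_lt_compat. }
  apply Rmult_le_reg_r with r; auto. rewrite Rmult_assoc Rinv_l; [|lra].
  rewrite Rmult_1_r Rmult_comm.
  replace r with (y + r - y) at 2 by ring.
  apply: abs_RInt_le_const; auto; [lra|].
  apply: ex_RInt_minus; auto. apply ex_RInt_const.
Qed.

(** Each double mean gains one order of regularity and costs half of the tolerance. A mean looks at
    most [r <= 1] to the right and upwards, hence the enlarged box [N + 1] in the induction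
    hypothesis. *)
Lemma smooth_approx (k : nat) (f : R -> R -> R) :
  Ck_on 0 plane f ->
  forall N e : R, 0 < e ->
  exists g, Ck_on k plane g /\
    forall x y, - N <= x <= N -> - N <= y <= N -> Rabs (g x y - f x y) <= e.
Proof.
  intros Hf. induction k as [|k IH]; intros N e He.
  - exists f. split; auto. intros x y _ _. rewrite Rminus_eq_0 Rabs_R0. lra.
  - destruct (IH (N + 1) (e / 2)) as [g [Hg Hgf]]; [lra|].
    assert (Hg0 : Ck_on 0 plane g) by (apply (Ck_on_le 0 k); [lia|easy]).
    destruct (uniform_continuity_2d g (- (N + 1)) (N + 1) (- (N + 1)) (N + 1))
      with (mkposreal (e / 2) ltac:(lra)) as [d Hd].
    { intros x y _ _. by apply Hg0. }
    assert (Hdp := cond_pos d).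
    (* Half of the modulus [d]: the closed interval of length [r] then lies strictly within distance
       [d] of its left end. *)
    set (r := Rmin 1 (d / 2)).
    assert (Hr : 0 < r) by (apply Rmin_glb_lt; lra).
    assert (Hr1 : r <= 1) by apply Rmin_l.
    assert (Hrd : r <= d / 2) by apply Rmin_r.
    exists (avg_x r (avg_y r g)). split.
    + apply Ck_on_avg; auto. lra.
    + intros x y Hx Hy.
      assert (H : Rabs (avg_x r (avg_y r g) x y - g x y) <= e / 2).
      { apply avg_y_close; auto.
        - apply Ck_on_swap, Ck_on_avg_y; auto. lra.
        - intros u Hu. apply avg_y_close; auto. intros v Hv. left.
          apply (Hd x y u v); try lra; apply Rabs_lt_between'; lra. }
      assert (H2 := Hgf x y ltac:(lra) ltac:(lra)).
      replace (avg_x r (avg_y r g) x y - f x y) with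
        ((avg_x r (avg_y r g) x y - g x y) + (g x y - f x y)) by ring.
      eapply Rle_trans; [apply Rabs_triang|]. lra.
Qed.

Lemma smooth_approx_strip (k : nat) (a b : R) (f : R -> R -> R) :
  a <= b -> (forall x y, a <= x <= b -> continuity_2d_pt f x y) ->
  forall N e : R, 0 < e ->
  exists g, Ck_on k plane g /\
    forall x y, a <= x <= b -> - N <= y <= N -> Rabs (g x y - f x y) <= e.
Proof.
  intros Hab Hf N e He.
  (* The projection of the line onto [[a, b]]. Composing with it extends [f] continuously to the
     whole plane without changing it over [[a, b]]. *)
  set (c := fun x : R => (a + b + Rabs (x - a) - Rabs (x - b)) / 2).
  assert (Hc : forall x, a <= c x <= b).
  { intros x. unfold c, Rabs. repeat destruct Rcase_abs; lra. }
  assert (Hcx : forall x, a <= x <= b -> c x = x).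
  { intros x Hx. unfold c, Rabs. repeat destruct Rcase_abs; lra. }
  destruct (smooth_approx k (fun x y => f (c x) y)) with
    (N := Rmax (Rmax (- a) b) N) (e := e) as [g [Hg Hgf]]; auto.
  - intros x y _. split; [|easy].
    apply (continuity_2d_pt_comp f (fun u _ => c u) (fun _ v => v)).
    + by apply Hf.
    + apply (continuity_1d_2d_pt_comp c (fun u _ => u)); [|apply continuity_2d_pt_id1].
      apply continuity_pt_filterlim.
      apply: (continuous_ext (fun x => scal (/ 2) (minus (plus (a + b) (Rabs (x - a))) (Rabs (x - b))))).
      { intros t. unfold c. change (/ 2 * ((a + b + Rabs (t - a)) - Rabs (t - b)) =
           (a + b + Rabs (t - a) - Rabs (t - b)) / 2). field. }
      apply: continuous_scal_r. apply: continuous_minus.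
      * apply: continuous_plus; [apply: continuous_const|].
        apply: continuous_Rabs_comp. apply: continuous_minus.
        apply: continuous_id. apply: continuous_const.
      * apply: continuous_Rabs_comp. apply: continuous_minus.
        apply: continuous_id. apply: continuous_const.
    + apply continuity_2d_pt_id2.
  - exists g. split; auto. intros x y Hx Hy.
    assert (H1 := Rmax_l (Rmax (- a) b) N). assert (H2 := Rmax_r (Rmax (- a) b) N).
    assert (H3 := Rmax_l (- a) b). assert (H4 := Rmax_r (- a) b).
    rewrite <- (Hcx x Hx) at 2. apply Hgf; lra.
Qed.

(** * Gronwall, implicit differentiation *)

(** Uniform continuity alone suffices: walking from the corner [(a, c)] in steps of [r / 2], the
    value changes by less than 1 at each step, and finitely many steps reach any point of the
    box. *)
Lemma continuous_2d_bounded (f : R -> R -> R) (a b c d : R) :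
  (forall x y, a <= x <= b -> c <= y <= d -> continuity_2d_pt f x y) ->
  exists M, 0 < M /\ forall x y, a <= x <= b -> c <= y <= d -> Rabs (f x y) <= M.
Proof.
  intros Hf.
  destruct (uniform_continuity_2d f a b c d Hf (mkposreal 1 Rlt_0_1)) as [r Hr].
  simpl in Hr. assert (Hr0 := cond_pos r).
  assert (Hn : forall n x y, a <= x <= b -> c <= y <= d ->
    x - a <= INR n * (r / 2) -> y - c <= INR n * (r / 2) ->
    Rabs (f x y) <= Rabs (f a c) + INR n).
  { induction n as [|n IH]; intros x y Hx Hy Hxn Hyn.
    - simpl in *. replace x with a by lra. replace y with c by lra. lra.
    - rewrite S_INR in Hxn, Hyn |- *.
      assert (H1 : exists x', a <= x' <= b /\ x' - a <= INR n * (r / 2) /\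
                     Rabs (x - x') < r).
      { assert (Hp := pos_INR n). assert (0 <= INR n * (r / 2)) by (apply Rmult_le_pos; lra).
        destruct (Rle_dec (x - r / 2) a).
        - exists a. split; [lra|split; [lra|]]. apply Rabs_lt_between'. lra.
        - exists (x - r / 2). split; [lra|split; [lra|]]. apply Rabs_lt_between'. lra. }
      assert (H2 : exists y', c <= y' <= d /\ y' - c <= INR n * (r / 2) /\
                     Rabs (y - y') < r).
      { assert (Hp := pos_INR n). assert (0 <= INR n * (r / 2)) by (apply Rmult_le_pos; lra).
        destruct (Rle_dec (y - r / 2) c).
        - exists c. split; [lra|split; [lra|]]. apply Rabs_lt_between'. lra.
        - exists (y - r / 2). split; [lra|split; [lra|]]. apply Rabs_lt_between'. lra. }
      destruct H1 as [x' [Hx' [Hx'n Hxx']]]. destruct H2 as [y' [Hy' [Hy'n Hyy']]].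
      assert (H3 := IH x' y' Hx' Hy' Hx'n Hy'n).
      assert (H4 := Hr x' y' x y Hx' Hy' Hx Hy Hxx' Hyy').
      assert (H5 := Rabs_triang_inv (f x y) (f x' y')). lra. }
  destruct (nfloor_ex (Rmax 0 (Rmax (b - a) (d - c) / (r / 2)))) as [n [_ Hn2]].
  { apply Rmax_l. }
  assert (Hbig : Rmax (b - a) (d - c) <= INR (S n) * (r / 2)).
  { apply Rmult_le_reg_r with (/ (r / 2)); [apply Rinv_0_lt_compat; lra|].
    rewrite Rmult_assoc Rinv_r; [|lra]. rewrite Rmult_1_r S_INR.
    assert (H := Rmax_r 0 (Rmax (b - a) (d - c) / (r / 2))). unfold Rdiv in *. lra. }
  assert (H1 := Rmax_l (b - a) (d - c)). assert (H2 := Rmax_r (b - a) (d - c)).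
  exists (Rabs (f a c) + INR (S n)). split.
  - assert (H := Rabs_pos (f a c)). rewrite S_INR. assert (H' := pos_INR n). lra.
  - intros x y Hx Hy. apply Hn; auto; lra.
Qed.

(** The square of [u] replaces its absolute value, which need not be differentiable at a zero. The
    product of this square and [exp (- 2 K |t - a|)] does not increase as [t] moves from [a] towards
    [b]; the sign [sg] records the direction, so both orders of [a] and [b] are covered. *)
Lemma gronwall_abs (u du : R -> R) (K a b : R) :
  (forall t, Rmin a b <= t <= Rmax a b ->
     is_derive u t (du t) /\ Rabs (du t) <= K * Rabs (u t)) ->
  Rabs (u b) <= Rabs (u a) * exp (K * Rabs (b - a)).
Proof.
  intros Hu. set (sg := match Rle_dec a b with left _ => 1 | right _ => -1 end).
  assert (Hsg : sg * (b - a) = Rabs (b - a) /\ sg * sg = 1 /\ Rabs sg = 1).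
  { unfold sg, Rabs. destruct Rle_dec; repeat destruct Rcase_abs; lra. }
  destruct Hsg as [Hs1 [Hs2 Hs3]].
  set (e := fun t => exp (- (2 * K * sg) * (t - a))).
  assert (He : forall t, is_derive e t (- (2 * K * sg) * e t)).
  { intros t. unfold e. apply: (is_derive_comp exp); [apply is_derive_exp|].
    auto_derive; [easy|ring]. }
  destruct (MVT_gen (fun t => u t * u t * e t) a b
    (fun t => (2 * u t * du t - 2 * K * sg * (u t * u t)) * e t)) as [c [Hc Ec]].
  - intros t Ht. destruct (Hu t) as [Hd _]; [lra|].
    replace ((2 * u t * du t - 2 * K * sg * (u t * u t)) * e t) with
      ((du t * u t + u t * du t) * e t + (u t * u t) * (- (2 * K * sg) * e t)) by ring.
    apply: (is_derive_mult (fun t => u t * u t) e); [|apply He|exact Rmult_comm].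
    apply: is_derive_mult; auto. exact Rmult_comm.
  - intros t Ht. destruct (Hu t Ht) as [Hd _].
    apply continuity_pt_filterlim. apply: continuous_mult.
    + apply: continuous_mult; apply: ex_derive_continuous; by exists (du t).
    + apply: ex_derive_continuous. eexists. apply He.
  - assert (Ha : e a = 1) by (unfold e; rewrite Rminus_eq_0 Rmult_0_r; apply exp_0).
    assert (Hle : (2 * u c * du c - 2 * K * sg * (u c * u c)) * e c * (b - a) <= 0).
    { destruct (Hu c Hc) as [_ Hb].
      (* Inserting [sg * sg = 1] turns the signed length [b - a] into [|b - a|] and attaches the
         remaining sign to [du c], where the absolute bound removes it. *)
      replace ((2 * u c * du c - 2 * K * sg * (u c * u c)) * e c * (b - a)) with
        (2 * e c * Rabs (b - a) * (sg * (u c * du c) - (sg * sg) * K * (u c * u c))).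
      2: { rewrite <- Hs1.
           transitivity (2 * e c * (b - a) * (sg * sg) * (u c * du c - sg * K * (u c * u c)) * 1);
             [|rewrite Hs2; ring].
           transitivity (2 * e c * (b - a) * (sg * sg * (u c * du c) - sg * (sg * sg) * K * (u c * u c)));
             [ring|]. rewrite Hs2. ring. }
      rewrite Hs2.
      assert (Hx : sg * (u c * du c) <= K * (u c * u c)).
      { eapply Rle_trans; [apply Rle_abs|]. rewrite !Rabs_mult Hs3.
        replace (K * (u c * u c)) with (Rabs (u c) * (K * Rabs (u c))).
        - rewrite Rmult_1_l. apply Rmult_le_compat_l; auto. apply Rabs_pos.
        - assert (H : Rabs (u c) * Rabs (u c) = u c * u c).
          { rewrite <- Rabs_mult. apply Rabs_pos_eq. apply Rle_0_sqr. }
          rewrite <- H. ring. }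
      assert (He0 : 0 <= 2 * e c * Rabs (b - a)).
      { apply Rmult_le_pos; [|apply Rabs_pos]. assert (H := exp_pos (- (2 * K * sg) * (c - a))).
        unfold e. lra. }
      assert (Hz : 0 <= 2 * e c * Rabs (b - a) * (K * (u c * u c) - sg * (u c * du c))).
      { apply Rmult_le_pos; lra. }
      lra. }
    assert (Hub : u b * u b * e b <= u a * u a) by (rewrite Ha in Ec; lra).
    apply Rsqr_incr_0_var.
    2: { apply Rmult_le_pos; [apply Rabs_pos|]. left. apply exp_pos. }
    rewrite Rsqr_mult -!Rsqr_abs.
    assert (Hee : e b * Rsqr (exp (K * Rabs (b - a))) = 1).
    { unfold e, Rsqr. rewrite -!exp_plus -Hs1.
      replace (_ + _) with 0 by ring. apply exp_0. }
    replace (Rsqr (u b)) with ((u b * u b * e b) * Rsqr (exp (K * Rabs (b - a)))).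
    + apply Rmult_le_compat_r; [apply Rle_0_sqr|]. exact Hub.
    + rewrite Rmult_assoc Hee. unfold Rsqr. ring.
Qed.

Lemma continuous_nonzero_pos (u : R -> R) (a b : R) :
  (forall t, continuous u t) -> (forall t, u t <> 0) -> 0 < u a -> 0 < u b.
Proof.
  intros Hc Hnz Ha. destruct (Rlt_dec 0 (u b)) as [H|H]; auto. exfalso.
  destruct (IVT_gen u a b 0) as [z [_ Hz]].
  - intros t. by apply continuity_pt_filterlim, Hc.
  - unfold Rmin, Rmax. repeat destruct Rle_dec; lra.
  - by apply (Hnz z).
Qed.

(** The form without division: the point [y = x] is included, and error terms can be added and
    absorbed. *)
Lemma is_derive_eps (f : R -> R) (x l : R) :
  is_derive f x l <->
  forall eps : posreal,
    locally x (fun y => Rabs (f y - f x - l * (y - x)) <= eps * Rabs (y - x)).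
Proof.
  rewrite is_derive_Reals. split.
  - intros H eps. destruct (H eps (cond_pos eps)) as [r Hr]. exists r.
    cut (forall y : R, Rabs (y - x) < r -> Rabs (f y - f x - l * (y - x)) <= eps * Rabs (y - x)).
    { intros H0 y Hy. by apply H0. }
    intros y Hy. destruct (Req_dec y x) as [->|Hyx].
    + rewrite !Rminus_eq_0 Rmult_0_r Rminus_eq_0 Rabs_R0. lra.
    + assert (Hh : y - x <> 0) by lra.
      assert (H1 := Hr (y - x) Hh Hy). replace (x + (y - x)) with y in H1 by ring.
      replace (f y - f x - l * (y - x)) with (((f y - f x) / (y - x) - l) * (y - x))
        by (field; lra).
      rewrite Rabs_mult. apply Rmult_le_compat_r; [apply Rabs_pos|lra].
  - intros H e He. destruct (H (mkposreal (e / 2) ltac:(lra))) as [r Hr]. exists r.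
    intros h Hh Hhr. assert (H1 := Hr (x + h)). simpl in H1.
    assert (Eh : @eq R (x + h - x) h) by (apply Rplus_minus_l).
    rewrite Eh in H1.
    assert (H2 : ball x r (x + h)).
    { change (Rabs (x + h - x) < r). by rewrite Eh. }
    specialize (H1 H2).
    replace ((f (x + h) - f x) / h - l) with ((f (x + h) - f x - l * h) / h) by (field; auto).
    unfold Rdiv. rewrite Rabs_mult. rewrite Rabs_inv.
    assert (Hp := Rabs_pos_lt h Hh).
    apply Rmult_lt_reg_r with (Rabs h); auto. rewrite Rmult_assoc Rinv_l; [|lra].
    assert (0 < e * Rabs h) by (apply Rmult_lt_0_compat; auto). lra.
Qed.

(** Differentiability of [Z] gives [a dphi = dq - b dp] up to an error small against
    [|dphi| + |dp|]. As [a] is nonzero, the share of [|dphi|] is absorbed on the left, which first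
    gives an increment of [phi] of order [t - r] and then its derivative. The functions [p] and [q]
    let one statement serve both partial derivatives of the label and the inverse of the height
    along a trajectory. *)
Lemma is_derive_implicit (Z : R -> R -> R) (phi p q : R -> R) (r a b dp dq : R) :
  differentiable_pt_lim Z (phi r) (p r) a b -> a <> 0 ->
  continuous phi r -> is_derive p r dp -> is_derive q r dq ->
  locally r (fun t => Z (phi t) (p t) = q t) ->
  is_derive phi r ((dq - b * dp) / a).
Proof.
  intros HZ Ha Hphi Hp Hq Heq. apply is_derive_eps. intros eps.
  assert (Ha' := Rabs_pos_lt a Ha). assert (He := cond_pos eps).
  assert (Heqr : Z (phi r) (p r) = q r) by exact (locally_singleton _ _ Heq).
  (* [M] bounds what remains after absorption, [|a| / 2 * P <= M * h], and [C] collects the final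
     error as [e * C * h]. *)
  set (M := Rabs dq + 1 + (Rabs b + 1) * (Rabs dp + 1)).
  assert (Hb := Rabs_pos b). assert (Hdp := Rabs_pos dp). assert (Hdq := Rabs_pos dq).
  assert (HM : 1 <= M).
  { assert (0 <= (Rabs b + 1) * (Rabs dp + 1)) by (apply Rmult_le_pos; lra). unfold M. lra. }
  set (C := 1 + Rabs b + (2 * M / Rabs a + Rabs dp + 1)).
  assert (HC : 1 <= C).
  { assert (0 <= 2 * M / Rabs a) by (apply Rdiv_le_0_compat; lra). unfold C. lra. }
  (* The three bounds on [e] keep the crude estimates of [p] and [q] within slope plus one, allow
     the absorption of [e * P] into [|a| * P], and bring the final error below [eps * |a| * h]. *)
  assert (He1 : 0 < Rmin 1 (Rmin (Rabs a / 2) (eps * Rabs a / C))).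
  { repeat apply Rmin_glb_lt; try lra. apply Rdiv_lt_0_compat; [|lra].
    by apply Rmult_lt_0_compat. }
  set (e := mkposreal _ He1).
  assert (E1 : e <= 1) by apply Rmin_l.
  assert (E2 : e <= Rabs a / 2) by (eapply Rle_trans; [apply Rmin_r|apply Rmin_l]).
  assert (E3 : e <= eps * Rabs a / C) by (eapply Rle_trans; [apply Rmin_r|apply Rmin_r]).
  assert (E0 := cond_pos e).
  destruct (HZ e) as [d Hd].
  assert (Hpc : continuous p r) by (apply: ex_derive_continuous; by exists dp).
  assert (L1 := proj1 (filterlim_locally _ _) Hphi d).
  assert (L2 := proj1 (filterlim_locally _ _) Hpc d).
  assert (L3 := proj1 (is_derive_eps p r dp) Hp e).
  assert (L4 := proj1 (is_derive_eps q r dq) Hq e).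
  generalize (filter_and _ _ (filter_and _ _ L1 L2)
    (filter_and _ _ (filter_and _ _ L3 L4) Heq)).
  apply filter_imp. intros t [[H1 H2] [[H3 H4] H5]].
  change (Rabs (phi t - phi r) < d) in H1. change (Rabs (p t - p r) < d) in H2.
  assert (H6 := Hd _ _ H1 H2). rewrite H5 Heqr in H6.
  set (h := Rabs (t - r)) in *.
  set (P := Rabs (phi t - phi r)) in *. set (S := Rabs (p t - p r)) in *.
  assert (Hh : 0 <= h) by apply Rabs_pos. assert (HP : 0 <= P) by apply Rabs_pos.
  assert (HS : 0 <= S) by apply Rabs_pos.
  assert (Hmax : Rmax P S <= P + S) by (apply Rmax_lub; lra).
  assert (H7 : Rabs (q t - q r - (a * (phi t - phi r) + b * (p t - p r))) <= e * (P + S)).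
  { eapply Rle_trans; [exact H6|]. apply Rmult_le_compat_l; lra. }
  assert (HSb : S <= (Rabs dp + 1) * h).
  { assert (Ht := Rabs_triang (p t - p r - dp * (t - r)) (dp * (t - r))).
    replace (p t - p r - dp * (t - r) + dp * (t - r)) with (p t - p r) in Ht by ring.
    rewrite (Rabs_mult dp) in Ht. fold h S in Ht.
    assert (e * h <= 1 * h) by (apply Rmult_le_compat_r; lra). lra. }
  assert (HQb : Rabs (q t - q r) <= (Rabs dq + 1) * h).
  { assert (Ht := Rabs_triang (q t - q r - dq * (t - r)) (dq * (t - r))).
    replace (q t - q r - dq * (t - r) + dq * (t - r)) with (q t - q r) in Ht by ring.
    rewrite (Rabs_mult dq) in Ht. fold h in Ht.
    assert (e * h <= 1 * h) by (apply Rmult_le_compat_r; lra). lra. }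
  assert (HPb : P <= 2 * M / Rabs a * h).
  { assert (Ht : Rabs a * P <= Rabs (q t - q r) + Rabs b * S + e * (P + S)).
    { unfold P at 1, S at 1. rewrite -!Rabs_mult.
      replace (a * (phi t - phi r)) with
        (- (q t - q r - (a * (phi t - phi r) + b * (p t - p r)))
          + ((q t - q r) + - (b * (p t - p r)))) by ring.
      eapply Rle_trans; [apply Rabs_triang|]. rewrite Rabs_Ropp.
      assert (Ht := Rabs_triang (q t - q r) (- (b * (p t - p r)))).
      rewrite Rabs_Ropp in Ht. lra. }
    assert (T1 : e * P <= Rabs a / 2 * P) by (apply Rmult_le_compat_r; lra).
    assert (T2 : e * S <= 1 * S) by (apply Rmult_le_compat_r; lra).
    assert (T3 : (Rabs b + 1) * S <= (Rabs b + 1) * ((Rabs dp + 1) * h))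
      by (apply Rmult_le_compat_l; lra).
    assert (T4 : Rabs a / 2 * P <= M * h) by (unfold M; lra).
    apply Rmult_le_reg_l with (Rabs a / 2); [lra|].
    replace (Rabs a / 2 * (2 * M / Rabs a * h)) with (M * h) by (field; lra). lra. }
  replace (phi t - phi r - (dq - b * dp) / a * (t - r)) with
    ((a * (phi t - phi r) - (dq - b * dp) * (t - r)) / a) by (field; auto).
  unfold Rdiv at 1. rewrite Rabs_mult Rabs_inv.
  apply Rmult_le_reg_r with (Rabs a); auto. rewrite Rmult_assoc Rinv_l; [|lra].
  rewrite Rmult_1_r.
  apply Rle_trans with (e * (C * h)).
  - replace (a * (phi t - phi r) - (dq - b * dp) * (t - r)) with
      (- (q t - q r - (a * (phi t - phi r) + b * (p t - p r)))
        + ((q t - q r - dq * (t - r)) + - (b * (p t - p r - dp * (t - r))))) by ring.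
    eapply Rle_trans; [apply Rabs_triang|]. rewrite Rabs_Ropp.
    assert (Ht := Rabs_triang (q t - q r - dq * (t - r)) (- (b * (p t - p r - dp * (t - r))))).
    rewrite Rabs_Ropp Rabs_mult in Ht.
    assert (T1 : Rabs b * Rabs (p t - p r - dp * (t - r)) <= Rabs b * (e * h))
      by (apply Rmult_le_compat_l; lra).
    assert (T2 : e * (P + S) <= e * ((2 * M / Rabs a + Rabs dp + 1) * h))
      by (apply Rmult_le_compat_l; lra).
    unfold C. lra.
  - replace (eps * h * Rabs a) with (eps * Rabs a / C * (C * h)) by (field; lra).
    apply Rmult_le_compat_r; auto. apply Rmult_le_pos; lra.
Qed.

(** * Smoothness of scalar flows *)

(** The parameter runs over the closed interval [[0, a]], which all trajectories keep to: on bounded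
    heights [dx g] is then bounded, which gives Gronwall its constant. The open set [J] around the
    interval provides derivatives of [g] up to its ends, and the extreme trajectories, [X 0 = 0] and
    [X a], bound the domain. *)
Record scalar_flow (J : R -> Prop) (g X : R -> R -> R) (y0 a : R) : Prop := {
  sf_open : open J;
  sf_sub : forall x, 0 <= x <= a -> J x;
  sf_range : forall s y, 0 <= s <= a -> 0 <= X s y <= a;
  sf_ode : forall s y, 0 <= s <= a -> is_derive (X s) y (g (X s y) y);
  sf_init : forall s, 0 <= s <= a -> X s y0 = s;
  sf_zero : forall y, X 0 y = 0
}.

Notation ostrip a := (vstrip (fun s => 0 < s < a)).

Lemma open_Ioo (a b : R) : open (fun s => a < s < b).
Proof. apply: open_and; [apply open_gt|apply open_lt]. Qed.

Lemma open_ostrip (a : R) : open (ostrip a).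
Proof. apply open_vstrip, open_Ioo. Qed.

Lemma scalar_flow_continuous_y J g X y0 a (s y : R) :
  scalar_flow J g X y0 a -> 0 <= s <= a -> continuous (X s) y.
Proof.
  intros F Hs. apply: ex_derive_continuous. eexists. by apply (sf_ode _ _ _ _ _ F).
Qed.

(* Gronwall in both directions of y. *)
Lemma scalar_flow_bilipschitz J g X y0 a (N : R) :
  scalar_flow J g X y0 a -> Ck_on 1 (vstrip J) g ->
  exists C, 0 < C /\ forall s1 s2 y, 0 <= s1 <= a -> 0 <= s2 <= a -> Rabs (y - y0) <= N ->
    Rabs (X s2 y - X s1 y) <= C * Rabs (s2 - s1) /\
    Rabs (s2 - s1) <= C * Rabs (X s2 y - X s1 y).
Proof.
  intros F Hg.
  destruct (continuous_2d_bounded (dx g) 0 a (y0 - N) (y0 + N)) as [K [HK HKb]].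
  { intros x y Hx _. apply (Ck_on_continuity 0 (vstrip J)); [by apply Ck_on_dx|].
    by apply (sf_sub _ _ _ _ _ F). }
  exists (exp (K * N)). split; [apply exp_pos|].
  intros s1 s2 y H1 H2 Hy.
  assert (HL : forall t, Rabs (t - y0) <= N ->
    is_derive (fun t => X s2 t - X s1 t) t (g (X s2 t) t - g (X s1 t) t) /\
    Rabs (g (X s2 t) t - g (X s1 t) t) <= K * Rabs (X s2 t - X s1 t)).
  { intros t Ht. split.
    - apply: is_derive_minus; by apply (sf_ode _ _ _ _ _ F).
    - assert (R1 := sf_range _ _ _ _ _ F s1 t H1). assert (R2 := sf_range _ _ _ _ _ F s2 t H2).
      assert (Hd : forall x, Rmin (X s1 t) (X s2 t) <= x <= Rmax (X s1 t) (X s2 t) ->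
        0 <= x <= a).
      { intros x. unfold Rmin, Rmax. destruct Rle_dec; lra. }
      destruct (MVT_gen (fun x => g x t) (X s1 t) (X s2 t) (fun x => dx g x t))
        as [c [Hc ->]].
      + intros x Hx. apply (Ck_on_is_dx 0 (vstrip J)); auto.
        apply (sf_sub _ _ _ _ _ F), Hd. simpl. lra.
      + intros x Hx. apply continuity_pt_filterlim. apply: ex_derive_continuous.
        exists (dx g x t). apply (Ck_on_is_dx 0 (vstrip J)); auto.
        apply (sf_sub _ _ _ _ _ F), Hd. simpl. lra.
      + rewrite Rabs_mult. apply Rmult_le_compat_r; [apply Rabs_pos|].
        apply HKb; auto. by apply Rabs_le_between'. }
  assert (HN : forall t, Rmin y0 y <= t <= Rmax y0 y -> Rabs (t - y0) <= N).
  { intros t. apply Rabs_le_between' in Hy.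
    intros Ht. apply Rabs_le_between'. revert Ht. unfold Rmin, Rmax. destruct Rle_dec; lra. }
  assert (HN' : forall t, Rmin y y0 <= t <= Rmax y y0 -> Rabs (t - y0) <= N).
  { intros t. rewrite Rmin_comm Rmax_comm. apply HN. }
  assert (G1 := gronwall_abs _ _ K y0 y (fun t Ht => HL t (HN t Ht))).
  assert (G2 := gronwall_abs _ _ K y y0 (fun t Ht => HL t (HN' t Ht))).
  simpl in G1, G2. rewrite (sf_init _ _ _ _ _ F s1 H1) (sf_init _ _ _ _ _ F s2 H2) in G1, G2.
  rewrite (Rabs_minus_sym y0 y) in G2.
  assert (HE : exp (K * Rabs (y - y0)) <= exp (K * N)).
  { destruct (Rmult_le_compat_l K _ _ (Rlt_le _ _ HK) Hy) as [E|E].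
    - left. by apply exp_increasing.
    - right. by rewrite E. }
  split; rewrite Rmult_comm; eapply Rle_trans; try eassumption;
    apply Rmult_le_compat_l; auto using Rabs_pos.
Qed.

(** By the lower Lipschitz bound the difference of two trajectories never vanishes, so it keeps the
    sign of [s2 - s1], its value at [y0]. *)
Lemma scalar_flow_mono J g X y0 a (s1 s2 y : R) :
  scalar_flow J g X y0 a -> Ck_on 1 (vstrip J) g ->
  0 <= s1 -> s1 < s2 -> s2 <= a -> X s1 y < X s2 y.
Proof.
  intros F Hg H1 H12 H2.
  apply Rminus_lt_0. apply (continuous_nonzero_pos (fun t => X s2 t - X s1 t) y0 y).
  - intros t. apply: continuous_minus; apply (scalar_flow_continuous_y _ _ _ _ _ _ _ F); lra.
  - intros t Ht. destruct (scalar_flow_bilipschitz _ _ _ _ _ (Rabs (t - y0)) F Hg) as [C [HC H]].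
    destruct (H s1 s2 t) as [_ HH]; try lra.
    rewrite Ht Rabs_R0 Rmult_0_r in HH. assert (H3 := Rabs_pos_lt (s2 - s1)). lra.
  - rewrite !(sf_init _ _ _ _ _ F); lra.
Qed.

Lemma scalar_flow_continuity J g X y0 a (s y : R) :
  scalar_flow J g X y0 a -> Ck_on 1 (vstrip J) g ->
  0 < s < a -> continuity_2d_pt X s y.
Proof.
  intros F Hg Hs eps. assert (He := cond_pos eps).
  destruct (scalar_flow_bilipschitz _ _ _ _ _ (Rabs (y - y0) + 1) F Hg) as [C [HC H]].
  assert (Hsc : continuous (X s) y)
    by (apply (scalar_flow_continuous_y _ _ _ _ _ _ _ F); lra).
  destruct (proj1 (filterlim_locally _ _) Hsc (pos_div_2 eps)) as [d Hd].
  destruct (open_Ioo 0 a s Hs) as [r Hr].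
  assert (Hp : 0 < Rmin (Rmin d 1) (Rmin r (eps / 2 / C))).
  { repeat apply Rmin_glb_lt; try apply cond_pos; try lra. apply Rdiv_lt_0_compat; lra. }
  exists (mkposreal _ Hp). simpl. intros u v Hu Hv.
  assert (M1 := Rmin_l (Rmin d 1) (Rmin r (eps / 2 / C))).
  assert (M2 := Rmin_r (Rmin d 1) (Rmin r (eps / 2 / C))).
  assert (M3 := Rmin_l d 1). assert (M4 := Rmin_r d 1).
  assert (M5 := Rmin_l r (eps / 2 / C)). assert (M6 := Rmin_r r (eps / 2 / C)).
  assert (Hu0 : 0 < u < a) by (apply Hr; apply: (Rlt_le_trans _ _ _ Hu); lra).
  assert (E1 : Rabs (X s v - X s y) < eps / 2) by (apply Hd; apply: (Rlt_le_trans _ _ _ Hv); lra).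
  destruct (H s u v) as [E2 _]; try lra.
  { replace (v - y0) with ((v - y) + (y - y0)) by ring.
    eapply Rle_trans; [apply Rabs_triang|]. lra. }
  assert (E3 : C * Rabs (u - s) < eps / 2).
  { replace (eps / 2) with (C * (eps / 2 / C)) by (field; lra).
    apply Rmult_lt_compat_l; lra. }
  replace (X u v - X s y) with ((X u v - X s v) + (X s v - X s y)) by ring.
  eapply Rle_lt_trans; [apply Rabs_triang|]. lra.
Qed.

(** The solution of the equation linearized along the trajectory of [s], with value 1 at [y0]. The
    closed form shows its positivity and its regularity. *)
Definition flow_jac (g X : R -> R -> R) (y0 s y : R) : R :=
  exp (RInt (fun t => dx g (X s t) t) y0 y).

Lemma continuous_path (f : R -> R -> R) (p : R -> R) (t : R) :
  continuity_2d_pt f (p t) t -> continuous p t -> continuous (fun t => f (p t) t) t.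
Proof.
  intros Hf Hp. apply (continuous_comp_2 p (fun t => t) f t); auto.
  - apply continuous_id.
  - by apply continuity_2d_pt_filterlim.
Qed.

(* The logarithm of the difference quotient solves [l' = dx g (xi t) t] with xi
   between the two trajectories. *)
Lemma scalar_flow_is_derive J g X y0 a (s y : R) :
  scalar_flow J g X y0 a -> Ck_on 1 (vstrip J) g ->
  0 < s < a -> is_derive (fun s => X s y) s (flow_jac g X y0 s y).
Proof.
  intros F Hg Hs. apply is_derive_Reals. intros eps Heps.
  set (l0 := fun t => RInt (fun t => dx g (X s t) t) y0 t).
  assert (Hdg : forall x t, 0 <= x <= a -> continuity_2d_pt (dx g) x t).
  { intros x t Hx. apply (Ck_on_continuity 0 (vstrip J)); [by apply Ck_on_dx|].
    by apply (sf_sub _ _ _ _ _ F). }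
  assert (Hci : forall t, continuous (fun t => dx g (X s t) t) t).
  { intros t. apply continuous_path.
    - apply Hdg. apply (sf_range _ _ _ _ _ F). lra.
    - apply (scalar_flow_continuous_y _ _ _ _ _ _ _ F). lra. }
  assert (Hl0 : forall t, is_derive l0 t (dx g (X s t) t)).
  { intros t. apply: (is_derive_RInt (fun t => dx g (X s t) t) l0 y0 t); auto.
    apply filter_forall. intros b. apply: RInt_correct.
    apply: ex_RInt_continuous. intros z _. apply Hci. }
  (* The estimate is made on logarithms: once [ln (q y)] is within [rho] of [l0 y], continuity of
     [exp] brings the difference quotient within [eps] of the Jacobian. *)
  destruct (proj1 (filterlim_locally _ _) (continuous_exp (l0 y)) (mkposreal eps Heps))
    as [rho Hrho].
  assert (Hrho0 := cond_pos rho).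
  set (N := Rabs (y - y0)). assert (HN : 0 <= N) by apply Rabs_pos.
  (* Tolerance for [dx g] per unit of height: over the length [N] it accumulates to less than [rho].
     The added 1 covers [N = 0]. *)
  assert (He : 0 < rho / 2 / (N + 1)) by (apply Rdiv_lt_0_compat; lra).
  destruct (uniform_continuity_2d (dx g) 0 a (y0 - N) (y0 + N)) with (mkposreal _ He)
    as [d Hd].
  { intros x t Hx _. by apply Hdg. }
  destruct (scalar_flow_bilipschitz _ _ _ _ _ N F Hg) as [C [HC HL]].
  destruct (open_Ioo 0 a s Hs) as [r Hr].
  assert (Hp : 0 < Rmin r (d / C)).
  { apply Rmin_glb_lt; [apply cond_pos|]. apply Rdiv_lt_0_compat; auto. apply cond_pos. }
  exists (mkposreal _ Hp). simpl. intros h Hh Hhr.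
  assert (M1 := Rmin_l r (d / C)). assert (M2 := Rmin_r r (d / C)).
  assert (Hsh : 0 < s + h < a).
  { apply Hr. change (Rabs (s + h - s) < r). rewrite Rplus_minus_l. lra. }
  set (q := fun t => (X (s + h) t - X s t) / h).
  (* Monotonicity in [s] makes the quotient positive for either sign of [h], so its logarithm is
     defined at every height. *)
  assert (Hq : forall t, 0 < q t).
  { intros t. unfold q. destruct (Rlt_dec 0 h) as [H0|H0].
    - assert (H1 := scalar_flow_mono _ _ _ _ _ s (s + h) t F Hg). 
      apply Rdiv_lt_0_compat; lra.
    - assert (H1 := scalar_flow_mono _ _ _ _ _ (s + h) s t F Hg).
      replace ((X (s + h) t - X s t) / h) with ((X s t - X (s + h) t) / (- h)) by (field; auto).
      apply Rdiv_lt_0_compat; lra. }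
  assert (Hxi : forall t, exists xi, 0 <= xi <= a /\
     Rabs (xi - X s t) <= Rabs (X (s + h) t - X s t) /\
     g (X (s + h) t) t - g (X s t) t = dx g xi t * (X (s + h) t - X s t)).
  { intros t.
    assert (R1 := sf_range _ _ _ _ _ F s t). assert (R2 := sf_range _ _ _ _ _ F (s + h) t).
    assert (Hdd : forall x, Rmin (X s t) (X (s + h) t) <= x <= Rmax (X s t) (X (s + h) t) ->
        0 <= x <= a).
    { intros x. unfold Rmin, Rmax. destruct Rle_dec; lra. }
    destruct (MVT_gen (fun x => g x t) (X s t) (X (s + h) t) (fun x => dx g x t))
      as [c [Hc Ec]].
    - intros x Hx. apply (Ck_on_is_dx 0 (vstrip J)); auto.
      apply (sf_sub _ _ _ _ _ F), Hdd. simpl. lra.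
    - intros x Hx. apply continuity_pt_filterlim. apply: ex_derive_continuous.
      exists (dx g x t). apply (Ck_on_is_dx 0 (vstrip J)); auto.
      apply (sf_sub _ _ _ _ _ F), Hdd. simpl. lra.
    - exists c. split; [auto|split; [|exact Ec]].
      revert Hc. unfold Rmin, Rmax, Rabs. destruct Rle_dec; repeat destruct Rcase_abs; lra. }
  set (dq := fun t => (g (X (s + h) t) t - g (X s t) t) / (X (s + h) t - X s t)).
  assert (Hnz : forall t, X (s + h) t - X s t <> 0).
  { intros t E. assert (H1 := Hq t). unfold q in H1. rewrite E in H1.
    unfold Rdiv in H1. rewrite Rmult_0_l in H1. lra. }
  assert (Hw : forall t, is_derive (fun t => ln (q t) - l0 t) t (dq t - dx g (X s t) t)).
  { intros t. apply: is_derive_minus; [|apply Hl0].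
    replace (dq t) with ((g (X (s + h) t) t - g (X s t) t) / h * / q t).
    2: { unfold dq, q. field. split; auto. }
    apply: (is_derive_comp ln q); [by apply is_derive_ln|].
    unfold q, Rdiv.
    apply: (is_derive_ext (fun t => / h * (X (s + h) t - X s t))).
    { intros z. apply Rmult_comm. }
    rewrite Rmult_comm. apply: is_derive_scal.
    apply: is_derive_minus; apply (sf_ode _ _ _ _ _ F); lra. }
  destruct (MVT_gen (fun t => ln (q t) - l0 t) y0 y (fun t => dq t - dx g (X s t) t))
    as [c [Hc Ec]].
  { intros t _. apply Hw. }
  { intros t _. apply continuity_pt_filterlim.
    apply (ex_derive_continuous (fun t => ln (q t) - l0 t)). eexists. apply Hw. }
  assert (Hcb : Rabs (c - y0) <= N).
  { unfold N. revert Hc. unfold Rmin, Rmax, Rabs. destruct Rle_dec; repeat destruct Rcase_abs; lra. }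
  destruct (Hxi c) as [xi [X1 [X2 X3]]].
  assert (Hdqc : dq c = dx g xi c) by (unfold dq; rewrite X3; field; auto).
  assert (Hsmall : Rabs (dx g xi c - dx g (X s c) c) < rho / 2 / (N + 1)).
  { destruct (HL s (s + h) c) as [E1 _]; try lra.
    rewrite Rplus_minus_l in E1.
    assert (C * Rabs h < d).
    { replace (pos d) with (C * (d / C)) by (field; lra). apply Rmult_lt_compat_l; lra. }
    apply Hd; auto.
    - apply (sf_range _ _ _ _ _ F). lra.
    - by apply Rabs_le_between'.
    - by apply Rabs_le_between'.
    - lra.
    - rewrite Rminus_eq_0 Rabs_R0. apply cond_pos. }
  assert (Hq0 : ln (q y0) - l0 y0 = 0).
  { unfold q, l0. rewrite !(sf_init _ _ _ _ _ F); try lra.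
    rewrite Rplus_minus_l RInt_point. unfold Rdiv. rewrite Rinv_r; auto. rewrite ln_1.
    apply Rminus_eq_0. }
  rewrite Hq0 Rminus_0_r Hdqc in Ec.
  assert (Hfin : Rabs (ln (q y) - l0 y) < rho).
  { rewrite Ec Rabs_mult. fold N.
    apply Rle_lt_trans with (rho / 2 / (N + 1) * (N + 1)).
    - apply Rmult_le_compat; try apply Rabs_pos; lra.
    - replace (rho / 2 / (N + 1) * (N + 1)) with (rho / 2) by (field; lra). lra. }
  assert (H1 := Hrho (ln (q y)) Hfin). rewrite exp_ln in H1; [|apply Hq].
  exact H1.
Qed.

(** If [X] is C^j, then so are both its partial derivatives, the Jacobian and [g (X s y) y], and [X]
    is C^(j+1). The Jacobian contains [dx g], which is only C^k; this is where the loop ends. *)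
Lemma scalar_flow_smooth J g X y0 a (k : nat) :
  scalar_flow J g X y0 a -> Ck_on (S k) (vstrip J) g ->
  Ck_on (S k) (ostrip a) X /\ Ck_on k (ostrip a) (flow_jac g X y0).
Proof.
  intros F Hg. assert (oS := open_ostrip a).
  assert (oJ : open (vstrip J)) by (apply open_vstrip; exact (sf_open _ _ _ _ _ F)).
  assert (Hg1 : Ck_on 1 (vstrip J) g) by (apply (Ck_on_le 1 (S k)); auto; lia).
  assert (Hin : forall s y, ostrip a (s, y) -> vstrip J (X s y, y)).
  { intros s y [H1 H2]. simpl in *. apply (sf_sub _ _ _ _ _ F).
    apply (sf_range _ _ _ _ _ F). simpl. lra. }
  assert (Hjac : forall j, (j <= k)%nat -> Ck_on j (ostrip a) X ->
            Ck_on j (ostrip a) (flow_jac g X y0)).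
  { intros j Hj HX. apply Ck_on_exp; auto.
    apply (Ck_on_RInt j (fun s => 0 < s < a) (fun s t => dx g (X s t) t)).
    - apply open_Ioo.
    - apply (Ck_on_comp j (ostrip a) (vstrip J) (dx g) X (fun _ t => t)); auto.
      + apply Ck_on_dx. apply (Ck_on_le (S j) (S k)); auto. lia.
      + by apply Ck_on_snd. }
  assert (HX : forall j, (j <= S k)%nat -> Ck_on j (ostrip a) X).
  { induction j as [|j IH]; intros Hj.
    - intros s y Hs. split; [|easy]. by apply (scalar_flow_continuity _ _ _ _ _ _ _ F).
    - assert (HXj := IH ltac:(lia)).
      apply (Ck_on_S j _ _ (flow_jac g X y0) (fun s y => g (X s y) y)); auto.
      + intros s y Hs. by apply (scalar_flow_is_derive J g X y0 a).
      + intros s y [H1 H2]. apply (sf_ode _ _ _ _ _ F). simpl in *. lra.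
      + apply Hjac; auto. lia.
      + apply (Ck_on_comp j (ostrip a) (vstrip J) g X (fun _ t => t)); auto.
        * apply (Ck_on_le j (S k)); auto. lia.
        * by apply Ck_on_snd. }
  split; [by apply HX|]. apply Hjac; auto.
Qed.

(** * The label, inverse of the flow map at fixed height *)

Definition flow_dom (X : R -> R -> R) (a : R) (p : R * R) : Prop :=
  0 < fst p < X a (snd p).

(** A choice operator selects the value. On [flow_dom] exactly one [s] qualifies; elsewhere the
    value is arbitrary. *)
Definition flow_label (X : R -> R -> R) (a x y : R) : R :=
  epsilon (inhabits 0) (fun s => 0 < s < a /\ X s y = x).

Lemma open_flow_dom J g X y0 a :
  scalar_flow J g X y0 a -> 0 <= a -> open (flow_dom X a).
Proof.
  intros F Ha. apply: open_and.
  - apply (open_comp fst (fun x => 0 < x)); [|apply open_gt].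
    intros [x y] _. apply: continuous_fst.
  - apply: (open_ext (fun p : R * R => 0 < X a (snd p) - fst p)).
    { intros p. lra. }
    apply (open_comp (fun p : R * R => X a (snd p) - fst p) (fun x => 0 < x)); [|apply open_gt].
    intros [x y] _.
    apply: (continuous_minus (fun p : R * R => X a (snd p)) fst).
    + apply: (continuous_comp snd (X a)). apply: continuous_snd.
      apply (scalar_flow_continuous_y _ _ _ _ _ _ _ F). lra.
    + apply: continuous_fst.
Qed.

Lemma flow_label_spec J g X y0 a (x y : R) :
  scalar_flow J g X y0 a -> Ck_on 1 (vstrip J) g -> 0 < a -> flow_dom X a (x, y) ->
  0 < flow_label X a x y < a /\ X (flow_label X a x y) y = x.
Proof.
  intros F Hg Ha [Hx1 Hx2]. simpl in Hx1, Hx2.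
  apply (epsilon_spec (inhabits 0) (fun s => 0 < s < a /\ X s y = x)).
  (* The projection onto [[0, a]]: the intermediate value theorem is applied to a function
     continuous on the whole line, while [X] is controlled only for [0 <= s <= a]. *)
  set (c := fun s : R => (a + Rabs s - Rabs (s - a)) / 2).
  assert (Hc : forall s, 0 <= c s <= a).
  { intros s. unfold c, Rabs. repeat destruct Rcase_abs; lra. }
  assert (Hcs : forall s, 0 <= s <= a -> c s = s).
  { intros s Hs. unfold c, Rabs. repeat destruct Rcase_abs; lra. }
  assert (Hcl : forall s s', Rabs (c s' - c s) <= Rabs (s' - s)).
  { intros s s'. unfold c, Rabs. repeat destruct Rcase_abs; lra. }
  destruct (scalar_flow_bilipschitz _ _ _ _ _ (Rabs (y - y0)) F Hg) as [C [HC HL]].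
  destruct (IVT_gen (fun s => X (c s) y) 0 a x) as [s [Hs Es]].
  - intros s e He. exists (e / C). split; [by apply Rdiv_lt_0_compat|].
    intros s' [_ Hs']. change (Rabs (X (c s') y - X (c s) y) < e).
    change (Rabs (s' - s) < e / C) in Hs'.
    destruct (HL (c s) (c s') y) as [E _]; auto; [lra|].
    apply Rle_lt_trans with (C * Rabs (s' - s)).
    + eapply Rle_trans; [exact E|]. apply Rmult_le_compat_l; auto. lra.
    + replace e with (C * (e / C)) by (field; lra). by apply Rmult_lt_compat_l.
  - rewrite !Hcs; try lra. rewrite (sf_zero _ _ _ _ _ F).
    rewrite Rmin_left; [|lra]. rewrite Rmax_right; lra.
  - rewrite Rmin_left in Hs; [|lra]. rewrite Rmax_right in Hs; [|lra].
    rewrite Hcs in Es; auto. exists s. split; auto.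
    assert (s <> 0). { intros ->. rewrite (sf_zero _ _ _ _ _ F) in Es. lra. }
    assert (s <> a). { intros ->. lra. } lra.
Qed.

Lemma flow_dom_graph J g X y0 a (s y : R) :
  scalar_flow J g X y0 a -> Ck_on 1 (vstrip J) g -> 0 < s < a ->
  flow_dom X a (X s y, y) /\ flow_label X a (X s y) y = s.
Proof.
  intros F Hg Hs.
  assert (HD : flow_dom X a (X s y, y)).
  { split; simpl.
    - rewrite <- (sf_zero _ _ _ _ _ F y). apply (scalar_flow_mono _ _ _ _ _ _ _ _ F Hg); lra.
    - apply (scalar_flow_mono _ _ _ _ _ _ _ _ F Hg); lra. }
  split; auto.
  destruct (flow_label_spec _ _ _ _ _ (X s y) y F Hg ltac:(lra) HD) as [H1 H2].
  destruct (Rtotal_order (flow_label X a (X s y) y) s) as [H|[H|H]]; auto.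
  - assert (HH := scalar_flow_mono _ _ _ _ _ _ _ y F Hg (Rlt_le _ _ (proj1 H1)) H). lra.
  - assert (HH := scalar_flow_mono _ _ _ _ _ s _ y F Hg (Rlt_le _ _ (proj1 Hs)) H). lra.
Qed.

(** The lower Lipschitz bound at the height [v] gives [|s' - s| <= C |u - X s v|], and the
    right-hand side is small because the single trajectory of [s] is continuous. *)
Lemma flow_label_continuity J g X y0 a (x y : R) :
  scalar_flow J g X y0 a -> Ck_on 1 (vstrip J) g -> 0 < a -> flow_dom X a (x, y) ->
  continuity_2d_pt (flow_label X a) x y.
Proof.
  intros F Hg Ha HD eps. assert (He := cond_pos eps).
  destruct (flow_label_spec _ _ _ _ _ x y F Hg Ha HD) as [Hs Es].
  set (s := flow_label X a x y) in *.
  destruct (scalar_flow_bilipschitz _ _ _ _ _ (Rabs (y - y0) + 1) F Hg) as [C [HC H]].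
  assert (He2 : 0 < eps / 2 / C) by (apply Rdiv_lt_0_compat; lra).
  assert (Hsc : continuous (X s) y)
    by (apply (scalar_flow_continuous_y _ _ _ _ _ _ _ F); lra).
  destruct (proj1 (filterlim_locally _ _) Hsc (mkposreal _ He2)) as [d Hd].
  destruct (open_locally_2d _ x y (open_flow_dom _ _ _ _ _ F ltac:(lra)) HD) as [r Hr].
  assert (Hp : 0 < Rmin (Rmin d 1) (Rmin r (eps / 2 / C))).
  { repeat apply Rmin_glb_lt; try apply cond_pos; try lra. }
  exists (mkposreal _ Hp). simpl. intros u v Hu Hv.
  assert (M1 := Rmin_l (Rmin d 1) (Rmin r (eps / 2 / C))).
  assert (M2 := Rmin_r (Rmin d 1) (Rmin r (eps / 2 / C))).
  assert (M3 := Rmin_l d 1). assert (M4 := Rmin_r d 1).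
  assert (M5 := Rmin_l r (eps / 2 / C)). assert (M6 := Rmin_r r (eps / 2 / C)).
  destruct (flow_label_spec _ _ _ _ _ u v F Hg Ha) as [Hs' Es'].
  { apply Hr; lra. }
  fold s. set (s' := flow_label X a u v) in *.
  assert (E1 : Rabs (X s v - X s y) < eps / 2 / C)
    by (apply Hd; apply: (Rlt_le_trans _ _ _ Hv); lra).
  destruct (H s s' v) as [_ E2]; try lra.
  { replace (v - y0) with ((v - y) + (y - y0)) by ring.
    eapply Rle_trans; [apply Rabs_triang|]. lra. }
  eapply Rle_lt_trans; [exact E2|].
  replace (pos eps) with (C * (eps / 2 / C + eps / 2 / C)) by (field; lra).
  apply Rmult_lt_compat_l; auto. rewrite Es'.
  replace (u - X s v) with ((u - x) + - (X s v - X s y)) by (rewrite Es; ring).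
  eapply Rle_lt_trans; [apply Rabs_triang|]. rewrite Rabs_Ropp. lra.
Qed.

(** Implicit differentiation of [X (psi x y) y = x] in each variable; the Jacobian never vanishes,
    being an exponential. *)
Lemma flow_label_is_derive J g X y0 a (x y : R) :
  scalar_flow J g X y0 a -> Ck_on 1 (vstrip J) g -> 0 < a -> flow_dom X a (x, y) ->
  is_derive (fun t => flow_label X a t y) x
    (/ flow_jac g X y0 (flow_label X a x y) y) /\
  is_derive (fun t => flow_label X a x t) y
    (- (g x y / flow_jac g X y0 (flow_label X a x y) y)).
Proof.
  intros F Hg Ha HD.
  destruct (flow_label_spec _ _ _ _ _ x y F Hg Ha HD) as [Hs Es].
  assert (Hc := flow_label_continuity _ _ _ _ _ x y F Hg Ha HD).
  assert (HZ : differentiable_pt_lim X (flow_label X a x y) y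
    (flow_jac g X y0 (flow_label X a x y) y) (g x y)).
  { destruct (scalar_flow_smooth _ _ _ _ _ 0 F Hg) as [HX Hj].
    rewrite <- Es at 3.
    apply (partials_differentiable (ostrip a) X (flow_jac g X y0) (fun s y => g (X s y) y)).
    - apply open_ostrip.
    - exact Hs.
    - intros u v Hu. by apply (scalar_flow_is_derive J g X y0 a).
    - apply (sf_ode _ _ _ _ _ F). lra.
    - by apply (Ck_on_continuity 0 (ostrip a)). }
  assert (Hnz : flow_jac g X y0 (flow_label X a x y) y <> 0) by apply Rgt_not_eq, exp_pos.
  assert (HL := open_locally_2d _ x y (open_flow_dom _ _ _ _ _ F ltac:(lra)) HD).
  split.
  - replace (/ flow_jac g X y0 (flow_label X a x y) y) with
      ((1 - g x y * 0) / flow_jac g X y0 (flow_label X a x y) y) by (field; auto).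
    apply (is_derive_implicit X (fun t => flow_label X a t y) (fun _ => y) (fun t => t)); auto.
    + apply (continuity_2d_pt_section (fun v u => flow_label X a u v)).
      intros e. destruct (Hc e) as [d Hd]. exists d. auto.
    + apply: is_derive_const.
    + apply: is_derive_id.
    + apply: filter_imp (locally_2d_1d_const_y _ _ _ HL). intros t Ht.
      by apply (flow_label_spec _ _ _ _ _ t y F Hg Ha Ht).
  - replace (- (g x y / flow_jac g X y0 (flow_label X a x y) y)) with
      ((0 - g x y * 1) / flow_jac g X y0 (flow_label X a x y) y) by (field; auto).
    apply (is_derive_implicit X (fun t => flow_label X a x t) (fun t => t) (fun _ => x)); auto.
    + by apply continuity_2d_pt_section.
    + apply: is_derive_id.
    + apply: is_derive_const.
    + apply: filter_imp (locally_2d_1d_const_x _ _ _ HL). intros t Ht.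
      by apply (flow_label_spec _ _ _ _ _ x t F Hg Ha Ht).
Qed.

(** Both partial derivatives are expressions in the label itself, so its regularity improves order
    by order. The C^k Jacobian enters only through these partials, so the label reaches C^(k+1),
    like [X]. *)
Lemma flow_label_smooth J g X y0 a (k : nat) :
  scalar_flow J g X y0 a -> Ck_on (S k) (vstrip J) g -> 0 < a ->
  Ck_on (S k) (flow_dom X a) (flow_label X a).
Proof.
  intros F Hg Ha.
  assert (oD := open_flow_dom _ _ _ _ _ F (Rlt_le _ _ Ha)).
  assert (Hg1 : Ck_on 1 (vstrip J) g) by (apply (Ck_on_le 1 (S k)); auto; lia).
  destruct (scalar_flow_smooth _ _ _ _ _ k F Hg) as [HX Hj].
  assert (Hall : forall j, (j <= S k)%nat -> Ck_on j (flow_dom X a) (flow_label X a)).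
  { induction j as [|j IH]; intros Hjk.
    - intros x y HD. split; [|easy]. by apply (flow_label_continuity J g X y0 a).
    - assert (H0 := IH ltac:(lia)).
      assert (Hinv : Ck_on j (flow_dom X a)
                (fun x y => / flow_jac g X y0 (flow_label X a x y) y)).
      { apply Ck_on_inv; auto.
        - intros x y _. apply Rgt_not_eq, exp_pos.
        - apply (Ck_on_comp j (flow_dom X a) (ostrip a) (flow_jac g X y0)
            (flow_label X a) (fun _ y => y)); auto.
          + apply open_ostrip.
          + intros x y HD. apply (flow_label_spec _ _ _ _ _ x y F Hg1 Ha HD).
          + apply (Ck_on_le j k); auto. lia.
          + by apply Ck_on_snd. }
      apply (Ck_on_S j _ _ (fun x y => / flow_jac g X y0 (flow_label X a x y) y)
        (fun x y => - (g x y / flow_jac g X y0 (flow_label X a x y) y))); auto.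
      + intros x y HD. by apply (flow_label_is_derive J g X y0 a).
      + intros x y HD. by apply (flow_label_is_derive J g X y0 a).
      + apply Ck_on_opp; auto. apply Ck_on_mult; auto.
        apply (Ck_on_sub _ _ (vstrip J)).
        * intros [x y] [H1 H2]. simpl in *. apply (sf_sub _ _ _ _ _ F). simpl.
          assert (R1 := sf_range _ _ _ _ _ F a y). lra.
        * apply (Ck_on_le j (S k)); auto. lia. }
  by apply Hall.
Qed.

(** * The parallel Laplacian in flow coordinates *)

Lemma dx_plus_scal (D : R * R -> Prop) (u w : R -> R -> R) (c x y : R) :
  Ck_on 1 D u -> Ck_on 1 D w -> D (x, y) ->
  dx (fun x y => u x y + c * w x y) x y = dx u x y + c * dx w x y.
Proof.
  intros Hu Hw HD. apply is_derive_unique. apply: is_derive_plus.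
  - by apply (Ck_on_is_dx 0 D).
  - apply: is_derive_scal. by apply (Ck_on_is_dx 0 D).
Qed.

Lemma dy_plus_scal (D : R * R -> Prop) (u w : R -> R -> R) (c x y : R) :
  Ck_on 1 D u -> Ck_on 1 D w -> D (x, y) ->
  dy (fun x y => u x y + c * w x y) x y = dy u x y + c * dy w x y.
Proof.
  intros Hu Hw HD. apply is_derive_unique. apply: is_derive_plus.
  - by apply (Ck_on_is_dy 0 D).
  - apply: is_derive_scal. by apply (Ck_on_is_dy 0 D).
Qed.

Lemma Ck_on_plus_scal (k : nat) (D : R * R -> Prop) (u w : R -> R -> R) (c : R) :
  open D -> Ck_on k D u -> Ck_on k D w ->
  Ck_on k D (fun x y => u x y + c * w x y).
Proof.
  intros oD Hu Hw. apply Ck_on_plus; auto. apply Ck_on_mult; auto.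
  by apply Ck_on_const.
Qed.

(** The bounds [M n] may grow at any speed. With [T n] at least [(n + 1) M n] and unbounded, taking
    for [nu eps] the index where [T] passes [1 / eps] gives
    [eps * M (nu eps) <= 1 / (nu eps + 1)]. *)
Lemma diagonal_index (M : nat -> R) :
  (forall n, 0 < M n) ->
  exists nu : R -> nat, forall n, exists d, 0 < d /\
    forall eps, 0 < eps < d -> (n <= nu eps)%nat /\ eps * M (nu eps) <= / (INR n + 1).
Proof.
  intros HM.
  (* The partial sum dominates [M n] and makes [T] increasing; the summand 1 ensures [T n >= n + 1],
     hence [T] is unbounded. *)
  set (T := fun n => (INR n + 1) * (1 + sum_f_R0 M n)).
  assert (HS : forall n, M n <= sum_f_R0 M n).
  { intros [|n]; simpl; [lra|].
    assert (H := cond_pos_sum M n (fun i => Rlt_le _ _ (HM i))). lra. }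
  assert (HT : forall n, T n < T (S n)).
  { intros n. unfold T. rewrite S_INR. simpl sum_f_R0.
    assert (H1 := HM (S n)). assert (H2 := HS n). assert (H3 := HM n).
    assert (H4 := pos_INR n). apply Rmult_le_0_lt_compat; lra. }
  assert (HTle : forall n m, (n <= m)%nat -> T n <= T m).
  { intros n m Hnm. induction Hnm; [lra|]. assert (H := HT m). lra. }
  assert (HTn : forall n, INR n + 1 <= T n).
  { intros n. unfold T. rewrite <- (Rmult_1_r (INR n + 1)) at 1.
    assert (H2 := HS n). assert (H3 := HM n). assert (H4 := pos_INR n).
    apply Rmult_le_compat_l; lra. }
  assert (HE : forall k r, T O <= r -> r < T k -> exists n, T n <= r < T (S n)).
  { induction k as [|k IH]; intros r H0 Hk; [lra|].
    destruct (Rlt_dec r (T k)) as [H|H]; [by apply IH|]. exists k. lra. }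
  (* For large [eps], with [1 / eps < T 0], no index qualifies and the choice is arbitrary; the
     claim concerns only [eps] below [1 / T n]. *)
  exists (fun eps => epsilon (inhabits O) (fun n => T n <= / eps < T (S n))).
  intros n. exists (/ T n). split.
  { apply Rinv_0_lt_compat. assert (H := HTn n). assert (H4 := pos_INR n). lra. }
  intros eps [He1 He2].
  assert (HTpos : 0 < T n). { assert (H := HTn n). assert (H4 := pos_INR n). lra. }
  assert (Hr : T n < / eps).
  { rewrite <- (Rinv_inv (T n)). apply Rinv_lt_contravar; auto.
    apply Rmult_lt_0_compat; auto. by apply Rinv_0_lt_compat. }
  assert (Hex : exists n, T n <= / eps < T (S n)).
  { destruct (nfloor_ex (/ eps)) as [k [_ Hk]].
    - left. by apply Rinv_0_lt_compat.
    - apply (HE k).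
      + assert (H := HTle O n ltac:(lia)). lra.
      + assert (H := HTn k). lra. }
  assert (Hnu := epsilon_spec (inhabits O) _ Hex).
  set (nu := epsilon _ _) in *. destruct Hnu as [N1 N2].
  assert (Hle : (n <= nu)%nat).
  { destruct (Nat.le_gt_cases n nu) as [H|H]; auto.
    assert (H' := HTle (S nu) n H). lra. }
  split; auto.
  assert (Hni : INR n <= INR nu) by by apply le_INR.
  assert (H4 := pos_INR n).
  assert (HMT : M nu * (INR nu + 1) <= T nu).
  { unfold T. rewrite Rmult_comm. apply Rmult_le_compat_l; [lra|].
    assert (H2 := HS nu). lra. }
  apply Rmult_le_reg_r with (INR n + 1); [lra|]. rewrite Rinv_l; [|lra].
  apply Rle_trans with (eps * (M nu * (INR nu + 1))).
  { rewrite Rmult_assoc. apply Rmult_le_compat_l; [lra|].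
    apply Rmult_le_compat_l; [|lra]. left. apply HM. }
  apply Rle_trans with (eps * / eps); [|right; apply Rinv_r; lra].
  apply Rmult_le_compat_l; lra.
Qed.

Lemma Ck_on_dx_dy (D : R * R -> Prop) (f : R -> R -> R) (x y : R) :
  open D -> Ck_on 2 D f -> D (x, y) -> dx (dy f) x y = dy (dx f) x y.
Proof.
  intros oD Hf Dxy. apply: Schwarz.
  - destruct (open_locally_2d D x y oD Dxy) as [r Hr]. exists r.
    intros u v Hu Hv. assert (H := Hf u v (Hr u v Hu Hv)).
    split; [|split; [|split]]; apply H.
  - apply (Ck_on_continuity 0 D (dx (dy f))); auto. by apply Ck_on_dx, Ck_on_dy.
  - apply (Ck_on_continuity 0 D (dy (dx f))); auto. by apply Ck_on_dy, Ck_on_dx.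
Qed.

(** The interface between the analysis of the operators and the geometry of the field. By [gf_axis]
    the field is the vertical unit vector on the initial line, so that there the parallel derivative
    is [dy]. *)
Record graph_field (Bx By : R -> R -> R) (J : R -> Prop) (g X : R -> R -> R)
    (y0 a : R) : Prop := {
  gf_flow : scalar_flow J g X y0 a;
  gf_pos : 0 < a;
  gf_slope : Ck_on 5 (vstrip J) g;
  gf_bx : Ck_on 5 (vstrip J) (bx Bx By);
  gf_by : Ck_on 5 (vstrip J) (by_ Bx By);
  gf_by_pos : forall x y, J x -> 0 < by_ Bx By x y;
  gf_ratio : forall x y, J x -> bx Bx By x y = g x y * by_ Bx By x y;
  gf_axis : forall x, J x -> bx Bx By x y0 = 0 /\ by_ Bx By x y0 = 1
}.

(** * Existence, uniqueness and approximation for the parallel Laplacian of a graph field *)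

Section GraphField.
Variables (Bx By : R -> R -> R) (J : R -> Prop) (g X : R -> R -> R) (y0 a : R).
Hypothesis GF : graph_field Bx By J g X y0 a.

Local Notation psi := (flow_label X a).
Local Notation dom := (flow_dom X a).
Local Notation jac := (flow_jac g X y0).
Local Notation bY := (by_ Bx By).

Let FL := gf_flow _ _ _ _ _ _ _ GF.

Lemma gf_slope1 : Ck_on 1 (vstrip J) g.
Proof. apply (Ck_on_le 1 5); [lia|apply (gf_slope _ _ _ _ _ _ _ GF)]. Qed.

Lemma gf_open_dom : open dom.
Proof. apply (open_flow_dom J g X y0 a FL). left. exact (gf_pos _ _ _ _ _ _ _ GF). Qed.

Lemma gf_dom_J (x y : R) : dom (x, y) -> J x.
Proof.
  intros [H1 H2]. simpl in *. apply (sf_sub _ _ _ _ _ FL).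
  assert (H := gf_pos _ _ _ _ _ _ _ GF).
  assert (R1 := sf_range _ _ _ _ _ FL a y). lra.
Qed.

Lemma gf_dom_strip (p : R * R) : dom p -> vstrip J p.
Proof. destruct p as [x y]. apply gf_dom_J. Qed.

Lemma gf_bx_dom (k : nat) : (k <= 5)%nat -> Ck_on k dom (bx Bx By).
Proof.
  intros Hk. apply (Ck_on_le k 5); [exact Hk|].
  exact (Ck_on_sub 5 _ _ _ gf_dom_strip (gf_bx _ _ _ _ _ _ _ GF)).
Qed.

Lemma gf_by_dom (k : nat) : (k <= 5)%nat -> Ck_on k dom bY.
Proof.
  intros Hk. apply (Ck_on_le k 5); [exact Hk|].
  exact (Ck_on_sub 5 _ _ _ gf_dom_strip (gf_by _ _ _ _ _ _ _ GF)).
Qed.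

Lemma gf_label (x y : R) : dom (x, y) -> 0 < psi x y < a /\ X (psi x y) y = x.
Proof.
  apply (flow_label_spec J g X y0 a x y FL gf_slope1).
  exact (gf_pos _ _ _ _ _ _ _ GF).
Qed.

Lemma gf_graph (s y : R) : 0 < s < a -> dom (X s y, y) /\ psi (X s y) y = s.
Proof. apply (flow_dom_graph J g X y0 a s y FL gf_slope1). Qed.

Lemma gf_label_smooth : Ck_on 5 dom psi.
Proof.
  apply (flow_label_smooth J g X y0 a 4 FL); apply GF.
Qed.

Lemma gf_flow_smooth : Ck_on 5 (ostrip a) X.
Proof. apply (scalar_flow_smooth J g X y0 a 4 FL). apply GF. Qed.

Lemma gf_jac_smooth : Ck_on 4 (ostrip a) jac.
Proof. apply (scalar_flow_smooth J g X y0 a 4 FL). apply GF. Qed.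

Lemma gf_label_partials (x y : R) :
  dom (x, y) -> dx psi x y = / jac (psi x y) y /\ dy psi x y = - (g x y * dx psi x y).
Proof.
  intros HD.
  destruct (flow_label_is_derive J g X y0 a x y FL gf_slope1 (gf_pos _ _ _ _ _ _ _ GF) HD)
    as [H1 H2].
  apply is_derive_unique in H1, H2.
  change (dx psi x y = / jac (psi x y) y) in H1.
  change (dy psi x y = - (g x y / jac (psi x y) y)) in H2.
  split; auto. rewrite H1 H2. reflexivity.
Qed.

Lemma gf_dx_label_pos (x y : R) : dom (x, y) -> 0 < dx psi x y.
Proof.
  intros HD. rewrite (proj1 (gf_label_partials x y HD)).
  apply Rinv_0_lt_compat, exp_pos.
Qed.

Lemma Ck_on_label_comp (k : nat) (V : R -> R -> R) :
  (k <= 5)%nat -> Ck_on k (ostrip a) V -> Ck_on k dom (fun x y => V (psi x y) y).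
Proof.
  intros Hk HV. assert (oD := gf_open_dom).
  apply (Ck_on_comp k dom (ostrip a) V psi (fun _ y => y)); auto.
  - apply open_ostrip.
  - intros x y HD. apply (gf_label x y HD).
  - apply (Ck_on_le k 5); auto. apply gf_label_smooth.
  - by apply Ck_on_snd.
Qed.

Lemma Ck_on_flow_comp (k : nat) (v : R -> R -> R) :
  (k <= 5)%nat -> Ck_on k dom v -> Ck_on k (ostrip a) (fun s y => v (X s y) y).
Proof.
  intros Hk Hv. assert (oS := open_ostrip a).
  apply (Ck_on_comp k (ostrip a) dom v X (fun _ y => y)); auto.
  - apply gf_open_dom.
  - intros s y Hs. apply (gf_graph s y Hs).
  - apply (Ck_on_le k 5); auto. apply gf_flow_smooth.
  - by apply Ck_on_snd.
Qed.

(** The operator [g dx + dy] differentiates along trajectories and annihilates [psi], so only the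
    explicit dependence of [V] on the height survives. *)
Lemma slope_derivative_label (V : R -> R -> R) (x y : R) :
  Ck_on 1 (ostrip a) V -> dom (x, y) ->
  g x y * dx (fun x y => V (psi x y) y) x y + dy (fun x y => V (psi x y) y) x y
  = dy V (psi x y) y.
Proof.
  intros HV HD. assert (oS := open_ostrip a).
  destruct (gf_label x y HD) as [Hs _].
  assert (HZ := Ck_on_differentiable 0 (ostrip a) V (psi x y) y oS HV Hs).
  assert (H1 : dx (fun x y => V (psi x y) y) x y =
    dx V (psi x y) y * dx psi x y + dy V (psi x y) y * 0).
  { apply is_derive_unique. apply (is_derive_comp_2d V (fun t => psi t y) (fun _ => y)); auto.
    - apply (Ck_on_is_dx 4 dom); auto. apply gf_label_smooth.
    - apply: is_derive_const. }
  assert (H2 : dy (fun x y => V (psi x y) y) x y =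
    dx V (psi x y) y * dy psi x y + dy V (psi x y) y * 1).
  { apply is_derive_unique. apply (is_derive_comp_2d V (fun t => psi x t) (fun t => t)); auto.
    - apply (Ck_on_is_dy 4 dom); auto. apply gf_label_smooth.
    - apply: is_derive_id. }
  rewrite H1 H2 (proj2 (gf_label_partials x y HD)). ring.
Qed.

Lemma is_derive_along_flow (v : R -> R -> R) (s y : R) :
  Ck_on 1 dom v -> 0 < s < a ->
  is_derive (fun y => v (X s y) y) y
    (g (X s y) y * dx v (X s y) y + dy v (X s y) y).
Proof.
  intros Hv Hs.
  replace (g (X s y) y * dx v (X s y) y + dy v (X s y) y) with
    (dx v (X s y) y * g (X s y) y + dy v (X s y) y * 1) by ring.
  apply (is_derive_comp_2d v (X s) (fun y => y)).
  - apply (Ck_on_differentiable 0 dom); auto. apply gf_open_dom. apply (gf_graph s y Hs).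
  - apply (sf_ode _ _ _ _ _ FL). lra.
  - apply: is_derive_id.
Qed.

(* As [b] is proportional to the rotated gradient [(- dy psi, dx psi)], the field
   [(b . grad u) b] equals [par_flux u] times a divergence-free field. *)
Definition par_flux (u : R -> R -> R) (x y : R) : R :=
  grad_par Bx By u x y * bY x y / dx psi x y.

Lemma grad_par_slope (u : R -> R -> R) (x y : R) :
  dom (x, y) -> grad_par Bx By u x y = bY x y * (g x y * dx u x y + dy u x y).
Proof.
  intros HD. unfold grad_par.
  rewrite (gf_ratio _ _ _ _ _ _ _ GF x y (gf_dom_J x y HD)). ring.
Qed.

Lemma grad_par_smooth (k : nat) (u : R -> R -> R) :
  (k <= 5)%nat -> Ck_on (S k) dom u -> Ck_on k dom (grad_par Bx By u).
Proof.
  intros Hk Hu. assert (oD := gf_open_dom).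
  apply Ck_on_plus; [exact oD| |]; (apply Ck_on_mult; [exact oD| |]);
    [by apply Ck_on_dx|by apply gf_bx_dom|by apply Ck_on_dy|by apply gf_by_dom].
Qed.

Lemma par_flux_smooth (k : nat) (u : R -> R -> R) :
  (k <= 4)%nat -> Ck_on (S k) dom u -> Ck_on k dom (par_flux u).
Proof.
  intros Hk Hu. assert (oD := gf_open_dom).
  apply Ck_on_div; auto.
  - intros x y HD. by apply Rgt_not_eq, gf_dx_label_pos.
  - apply Ck_on_mult; auto.
    + apply grad_par_smooth; auto.
    + apply gf_by_dom. lia.
  - apply (Ck_on_le k 4); auto. apply Ck_on_dx, gf_label_smooth.
Qed.

(** In the divergence of [par_flux u] times [(- dy psi, dx psi)] the mixed second derivatives of
    [psi] cancel by Schwarz. Replacing [dy psi] by [- g dx psi] leaves the derivative of the flux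
    along trajectories. *)
Lemma Lap_par_flux (u : R -> R -> R) (x y : R) :
  Ck_on 2 dom u -> dom (x, y) ->
  Lap_par Bx By u x y =
  dx psi x y * (g x y * dx (par_flux u) x y + dy (par_flux u) x y).
Proof.
  intros Hu HD. assert (oD := gf_open_dom).
  assert (HF := par_flux_smooth 1 u ltac:(lia) Hu).
  assert (Hpsi : Ck_on 2 dom psi) by (apply (Ck_on_le 2 5); [lia|apply gf_label_smooth]).
  unfold Lap_par.
  rewrite (dx_ext dom _ (fun x y => - (par_flux u x y * dy psi x y)) x y oD _ HD).
  2: { intros u' v H'. assert (Hp := gf_dx_label_pos u' v H').
       rewrite (proj2 (gf_label_partials u' v H')). unfold par_flux.
       rewrite (gf_ratio _ _ _ _ _ _ _ GF u' v (gf_dom_J _ _ H')). field. lra. }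
  rewrite (dy_ext dom _ (fun x y => par_flux u x y * dx psi x y) x y oD _ HD).
  2: { intros u' v H'. assert (Hp := gf_dx_label_pos u' v H').
       unfold par_flux. field. lra. }
  assert (H1 : dx (fun x y => - (par_flux u x y * dy psi x y)) x y =
    - (dx (par_flux u) x y * dy psi x y + par_flux u x y * dx (dy psi) x y)).
  { apply is_derive_unique. apply: is_derive_opp. apply: is_derive_mult.
    - by apply (Ck_on_is_dx 0 dom).
    - apply (Ck_on_is_dx 0 dom); auto. by apply Ck_on_dy.
    - exact Rmult_comm. }
  assert (H2 : dy (fun x y => par_flux u x y * dx psi x y) x y =
    dy (par_flux u) x y * dx psi x y + par_flux u x y * dy (dx psi) x y).
  { apply is_derive_unique. apply: is_derive_mult.
    - by apply (Ck_on_is_dy 0 dom).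
    - apply (Ck_on_is_dy 0 dom); auto. by apply Ck_on_dx.
    - exact Rmult_comm. }
  rewrite H1 H2 (Ck_on_dx_dy dom psi x y oD Hpsi HD) (proj2 (gf_label_partials x y HD)).
  ring.
Qed.

(** On the initial line all factors are normalized, so the Cauchy data become the initial values of
    the solution and of its flux without further constants. *)
Lemma gf_axis_dom (x0 : R) : 0 < x0 < a ->
  dom (x0, y0) /\ psi x0 y0 = x0 /\ g x0 y0 = 0 /\ bY x0 y0 = 1 /\ bx Bx By x0 y0 = 0 /\
  dx psi x0 y0 = 1 /\ jac x0 y0 = 1.
Proof.
  intros H0. destruct (gf_graph x0 y0 H0) as [H1 H2].
  rewrite (sf_init _ _ _ _ _ FL) in H1, H2; [|lra].
  assert (HJ := gf_dom_J _ _ H1).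
  destruct (gf_axis _ _ _ _ _ _ _ GF x0 HJ) as [H3 H4].
  assert (H5 := gf_ratio _ _ _ _ _ _ _ GF x0 y0 HJ). rewrite H3 H4 in H5.
  assert (H6 : jac x0 y0 = 1).
  { unfold flow_jac. rewrite RInt_point. apply exp_0. }
  repeat split; auto; try apply H1.
  - lra.
  - rewrite (proj1 (gf_label_partials _ _ H1)) H2 H6. apply Rinv_1.
Qed.

(** The right-hand side is prescribed in the coordinates (s, y), where both integrations and later
    the smoothing take place. The class C^4 is the common regularity of the Jacobian and the
    data. *)
Lemma Lap_par_solve (P Q : R -> R) (h : R -> R -> R) :
  Ck_on_interval 4 0 a P -> Ck_on_interval 4 0 a Q -> Ck_on 4 (ostrip a) h ->
  exists u, Ck_on 4 dom u /\
    (forall x y, dom (x, y) -> Lap_par Bx By u x y = h (psi x y) y) /\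
    forall x0, 0 < x0 < a ->
      u x0 y0 = P x0 /\ grad_par Bx By u x0 y0 = dy u x0 y0 /\ dy u x0 y0 = Q x0.
Proof.
  intros HP HQ Hh. assert (oS := open_ostrip a). assert (oD := gf_open_dom).
  assert (oI := open_Ioo 0 a).
  set (m := fun s y => bY (X s y) y * bY (X s y) y * jac s y).
  assert (Hby : Ck_on 4 (ostrip a) (fun s y => bY (X s y) y)).
  { apply (Ck_on_flow_comp 4 bY); [lia|]. apply gf_by_dom. lia. }
  assert (Hm : Ck_on 4 (ostrip a) m).
  { apply Ck_on_mult; [|apply Ck_on_mult|]; auto. apply gf_jac_smooth. }
  assert (Hmpos : forall s y, ostrip a (s, y) -> 0 < m s y).
  { intros s y Hs. unfold m.
    assert (H := gf_by_pos _ _ _ _ _ _ _ GF (X s y) y (gf_dom_J _ _ (proj1 (gf_graph s y Hs)))).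
    apply Rmult_lt_0_compat; [by apply Rmult_lt_0_compat|apply exp_pos]. }
  (* The flux [m dy V] after the first integration; it starts from [Q] because [m = 1] on the
     initial line. *)
  set (Fl := fun s y => Q s + RInt (fun t => h s t * jac s t) y0 y).
  assert (Hhj : Ck_on 4 (ostrip a) (fun s t => h s t * jac s t)).
  { apply Ck_on_mult; auto. apply gf_jac_smooth. }
  assert (HFl : Ck_on 4 (ostrip a) Fl).
  { apply Ck_on_plus; [exact oS| |].
    - by apply Ck_on_interval_vstrip.
    - by apply (Ck_on_RInt 4 (fun s => 0 < s < a) (fun s t => h s t * jac s t)). }
  assert (HmF : Ck_on 4 (ostrip a) (fun s t => / m s t * Fl s t)).
  { apply Ck_on_mult; [exact oS| |exact HFl]. apply Ck_on_inv; [exact oS| |exact Hm].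
    intros s y Hs. by apply Rgt_not_eq, Hmpos. }
  set (V := fun s y => P s + RInt (fun t => / m s t * Fl s t) y0 y).
  assert (HV : Ck_on 4 (ostrip a) V).
  { apply Ck_on_plus; [exact oS| |].
    - by apply Ck_on_interval_vstrip.
    - by apply (Ck_on_RInt 4 (fun s => 0 < s < a) (fun s t => / m s t * Fl s t)). }
  assert (dFl : forall s y, 0 < s < a -> dy Fl s y = h s y * jac s y).
  { intros s y Hs. apply is_derive_unique. rewrite <- (Rplus_0_l (h s y * jac s y)).
    apply: is_derive_plus; [apply: is_derive_const|].
    apply (is_derive_RInt_upper (fun s => 0 < s < a) (fun s t => h s t * jac s t)); auto.
    apply (Ck_on_le 0 4); auto. }
  assert (dV : forall s y, 0 < s < a -> dy V s y = / m s y * Fl s y).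
  { intros s y Hs. apply is_derive_unique. rewrite <- (Rplus_0_l (/ m s y * Fl s y)).
    apply: is_derive_plus; [apply: is_derive_const|].
    apply (is_derive_RInt_upper (fun s => 0 < s < a) (fun s t => / m s t * Fl s t)); auto.
    apply (Ck_on_le 0 4); auto. }
  set (u := fun x y => V (psi x y) y).
  assert (Hu : Ck_on 4 dom u) by (apply Ck_on_label_comp; auto).
  assert (Hslope : forall x y, dom (x, y) ->
    g x y * dx u x y + dy u x y = / m (psi x y) y * Fl (psi x y) y).
  { intros x y HD. rewrite <- dV; [|apply (gf_label x y HD)].
    exact (slope_derivative_label V x y (Ck_on_le 1 4 _ V ltac:(lia) HV) HD). }
  assert (Hflux : forall x y, dom (x, y) -> par_flux u x y = Fl (psi x y) y).
  { intros x y HD. unfold par_flux. rewrite grad_par_slope; auto. rewrite Hslope; auto.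
    destruct (gf_label x y HD) as [Hs Es].
    assert (Hm0 := Hmpos _ y Hs).
    assert (Hb := gf_by_pos _ _ _ _ _ _ _ GF x y (gf_dom_J _ _ HD)).
    rewrite (proj1 (gf_label_partials x y HD)). unfold m. rewrite Es.
    field. split; [apply Rgt_not_eq, exp_pos|lra]. }
  exists u. split; [auto|split].
  - intros x y HD. rewrite (Lap_par_flux u x y (Ck_on_le 2 4 dom u ltac:(lia) Hu) HD).
    rewrite (dx_ext dom _ _ x y oD Hflux HD) (dy_ext dom _ _ x y oD Hflux HD).
    rewrite (slope_derivative_label Fl x y (Ck_on_le 1 4 _ Fl ltac:(lia) HFl) HD).
    rewrite dFl; [|apply (gf_label x y HD)].
    rewrite (proj1 (gf_label_partials x y HD)). field. apply Rgt_not_eq, exp_pos.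
  - intros x0 H0.
    destruct (gf_axis_dom x0 H0) as [HD [E1 [E2 [E3 [E4 [E5 E6]]]]]].
    split; [|split].
    + unfold u, V. rewrite E1 RInt_point. apply Rplus_0_r.
    + unfold grad_par. rewrite E3 E4. ring.
    + assert (H := Hslope x0 y0 HD). rewrite E2 E1 in H.
      assert (Hm1 : m x0 y0 = 1).
      { unfold m. rewrite (sf_init _ _ _ _ _ FL); [|lra]. rewrite E3 E6. ring. }
      assert (HF1 : Fl x0 y0 = Q x0).
      { unfold Fl. rewrite RInt_point. apply Rplus_0_r. }
      rewrite Hm1 HF1 Rinv_1 in H. lra.
Qed.

Lemma is_derive_zero_const (f : R -> R) (x y : R) :
  (forall t, is_derive f t 0) -> f x = f y.
Proof.
  intros H. destruct (MVT_gen f x y (fun _ => 0)) as [c [_ E]].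
  - intros t _. apply H.
  - intros t _. apply continuity_pt_filterlim. apply: ex_derive_continuous. by exists 0.
  - lra.
Qed.

(** Along each trajectory the difference of the fluxes is constant and starts from zero. Equality of
    the fluxes, after cancelling the positive factors, says that [u - v] is constant along the
    trajectory as well, again from zero. Each point of the domain lies on such a trajectory. *)
Lemma Lap_par_unique (u v : R -> R -> R) :
  Ck_on 2 dom u -> Ck_on 2 dom v ->
  (forall x y, dom (x, y) -> Lap_par Bx By u x y = Lap_par Bx By v x y) ->
  (forall x0, 0 < x0 < a ->
     u x0 y0 = v x0 y0 /\ grad_par Bx By u x0 y0 = grad_par Bx By v x0 y0) ->
  forall x y, dom (x, y) -> u x y = v x y.
Proof.
  intros Hu Hv HL HC.
  assert (Hflux : forall s y, 0 < s < a -> par_flux u (X s y) y = par_flux v (X s y) y).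
  { intros s y Hs. apply Rminus_diag_uniq.
    rewrite (is_derive_zero_const
      (fun y => par_flux u (X s y) y - par_flux v (X s y) y) y y0).
    - rewrite (sf_init _ _ _ _ _ FL); [|lra]. unfold par_flux.
      rewrite (proj2 (HC s Hs)). ring.
    - intros t. destruct (gf_graph s t Hs) as [HD _].
      assert (Hp := gf_dx_label_pos _ _ HD).
      assert (H := HL _ _ HD). rewrite !Lap_par_flux in H; auto.
      apply Rmult_eq_reg_l in H; [|lra].
      assert (H1 := is_derive_along_flow (par_flux u) s t
        (par_flux_smooth 1 u ltac:(lia) Hu) Hs).
      assert (H2 := is_derive_along_flow (par_flux v) s t
        (par_flux_smooth 1 v ltac:(lia) Hv) Hs).
      rewrite <- H in H2. 
      replace 0 with (minus (g (X s t) t * dx (par_flux u) (X s t) t + dy (par_flux u) (X s t) t)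
        (g (X s t) t * dx (par_flux u) (X s t) t + dy (par_flux u) (X s t) t))
        by apply Rminus_eq_0.
      by apply: is_derive_minus. }
  assert (Huv : forall s y, 0 < s < a -> u (X s y) y = v (X s y) y).
  { intros s y Hs. apply Rminus_diag_uniq.
    rewrite (is_derive_zero_const (fun y => u (X s y) y - v (X s y) y) y y0).
    - rewrite (sf_init _ _ _ _ _ FL); [|lra]. rewrite (proj1 (HC s Hs)). ring.
    - intros t. destruct (gf_graph s t Hs) as [HD _].
      assert (Hp := gf_dx_label_pos _ _ HD).
      assert (Hb := gf_by_pos _ _ _ _ _ _ _ GF _ t (gf_dom_J _ _ HD)).
      assert (H := Hflux s t Hs). unfold par_flux in H.
      rewrite !grad_par_slope in H; auto.
      apply Rmult_eq_reg_r in H; [|apply Rinv_neq_0_compat; lra].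
      apply Rmult_eq_reg_r in H; [|lra].
      apply Rmult_eq_reg_l in H; [|lra].
      assert (H1 := is_derive_along_flow u s t (Ck_on_le 1 2 _ _ ltac:(lia) Hu) Hs).
      assert (H2 := is_derive_along_flow v s t (Ck_on_le 1 2 _ _ ltac:(lia) Hv) Hs).
      rewrite <- H in H2.
      replace 0 with (minus (g (X s t) t * dx u (X s t) t + dy u (X s t) t)
        (g (X s t) t * dx u (X s t) t + dy u (X s t) t)) by apply Rminus_eq_0.
      by apply: is_derive_minus. }
  intros x y HD. destruct (gf_label x y HD) as [Hs Es]. rewrite <- Es. by apply Huv.
Qed.

Lemma Lap_par_smooth (k : nat) (u : R -> R -> R) :
  (k <= 4)%nat -> Ck_on (S (S k)) dom u -> Ck_on k dom (Lap_par Bx By u).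
Proof.
  intros Hk Hu. assert (oD := gf_open_dom).
  assert (Hg := grad_par_smooth (S k) u ltac:(lia) Hu).
  assert (HX := gf_bx_dom (S k) ltac:(lia)). assert (HY := gf_by_dom (S k) ltac:(lia)).
  apply Ck_on_plus; [exact oD|apply Ck_on_dx|apply Ck_on_dy]; by apply Ck_on_mult.
Qed.

Lemma Lap_perp_smooth (k : nat) (u : R -> R -> R) :
  (k <= 4)%nat -> Ck_on (S (S k)) dom u -> Ck_on k dom (Lap_perp Bx By u).
Proof.
  intros Hk Hu. assert (oD := gf_open_dom).
  apply Ck_on_minus; auto; [|by apply Lap_par_smooth].
  apply Ck_on_plus; auto.
  - by apply Ck_on_dx, Ck_on_dx.
  - by apply Ck_on_dy, Ck_on_dy.
Qed.

Lemma grad_par_plus_scal (u w : R -> R -> R) (c x y : R) :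
  Ck_on 1 dom u -> Ck_on 1 dom w -> dom (x, y) ->
  grad_par Bx By (fun x y => u x y + c * w x y) x y =
  grad_par Bx By u x y + c * grad_par Bx By w x y.
Proof.
  intros Hu Hw HD. unfold grad_par.
  rewrite (dx_plus_scal dom u w) ?(dy_plus_scal dom u w); auto. ring.
Qed.

Lemma Lap_par_plus_scal (u w : R -> R -> R) (c x y : R) :
  Ck_on 2 dom u -> Ck_on 2 dom w -> dom (x, y) ->
  Lap_par Bx By (fun x y => u x y + c * w x y) x y =
  Lap_par Bx By u x y + c * Lap_par Bx By w x y.
Proof.
  intros Hu Hw HD. assert (oD := gf_open_dom). unfold Lap_par.
  assert (Hu1 := Ck_on_le 1 2 dom u ltac:(lia) Hu).
  assert (Hw1 := Ck_on_le 1 2 dom w ltac:(lia) Hw).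
  assert (HX := gf_bx_dom 1 ltac:(lia)). assert (HY := gf_by_dom 1 ltac:(lia)).
  assert (Gu := grad_par_smooth 1 u ltac:(lia) Hu).
  assert (Gw := grad_par_smooth 1 w ltac:(lia) Hw).
  rewrite (dx_ext dom _ (fun x y => grad_par Bx By u x y * bx Bx By x y
    + c * (grad_par Bx By w x y * bx Bx By x y)) x y oD _ HD).
  2: { intros s t H. rewrite grad_par_plus_scal; auto. ring. }
  rewrite (dy_ext dom _ (fun x y => grad_par Bx By u x y * bY x y
    + c * (grad_par Bx By w x y * bY x y)) x y oD _ HD).
  2: { intros s t H. rewrite grad_par_plus_scal; auto. ring. }
  rewrite (dx_plus_scal dom (fun x y => grad_par Bx By u x y * bx Bx By x y)
    (fun x y => grad_par Bx By w x y * bx Bx By x y)); auto using Ck_on_mult.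
  rewrite (dy_plus_scal dom (fun x y => grad_par Bx By u x y * bY x y)
    (fun x y => grad_par Bx By w x y * bY x y)); auto using Ck_on_mult.
  ring.
Qed.

Lemma Lap_plus_scal (u w : R -> R -> R) (c x y : R) :
  Ck_on 2 dom u -> Ck_on 2 dom w -> dom (x, y) ->
  Lap (fun x y => u x y + c * w x y) x y = Lap u x y + c * Lap w x y.
Proof.
  intros Hu Hw HD. assert (oD := gf_open_dom). unfold Lap.
  assert (Hu1 := Ck_on_le 1 2 dom u ltac:(lia) Hu).
  assert (Hw1 := Ck_on_le 1 2 dom w ltac:(lia) Hw).
  rewrite (dx_ext dom _ (fun x y => dx u x y + c * dx w x y) x y oD _ HD).
  2: { intros s t H. by apply (dx_plus_scal dom). }
  rewrite (dy_ext dom _ (fun x y => dy u x y + c * dy w x y) x y oD _ HD).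
  2: { intros s t H. by apply (dy_plus_scal dom). }
  rewrite (dx_plus_scal dom (dx u) (dx w)); auto using Ck_on_dx.
  rewrite (dy_plus_scal dom (dy u) (dy w)); auto using Ck_on_dy.
  ring.
Qed.

(** An open rectangle in the coordinates (s, y). The shift 3 leaves room between the two bounds on
    the label already at [n = 0], where they are [a / 3] and [2 a / 3]. *)
Definition exhaustion (n : nat) (p : R * R) : Prop :=
  dom p /\ a / (INR n + 3) < psi (fst p) (snd p) < a - a / (INR n + 3) /\
  - (INR n + 1) < snd p < INR n + 1.

Lemma exhaustion_mono (n m : nat) (p : R * R) :
  (n <= m)%nat -> exhaustion n p -> exhaustion m p.
Proof.
  intros Hnm [H1 [H2 H3]]. apply le_INR in Hnm. assert (Hn := pos_INR n).
  assert (Ha := gf_pos _ _ _ _ _ _ _ GF).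
  assert (H : a / (INR m + 3) <= a / (INR n + 3)).
  { apply Rmult_le_compat_l; [lra|]. apply Rinv_le_contravar; lra. }
  split; auto. lra.
Qed.

Lemma open_exhaustion (n : nat) : open (exhaustion n).
Proof.
  intros [x y] [H1 [H2 H3]]. simpl in H2, H3.
  assert (L1 := gf_open_dom _ H1).
  assert (Hc : continuity_2d_pt psi x y).
  { apply (Ck_on_continuity 5 dom); auto. apply gf_label_smooth. }
  apply continuity_2d_pt_filterlim in Hc.
  assert (L2 : locally (x, y) (fun p : R * R =>
    a / (INR n + 3) < psi (fst p) (snd p) < a - a / (INR n + 3)))
    by exact (Hc _ (open_Ioo _ _ _ H2)).
  assert (L3 : locally (x, y) (fun p : R * R => - (INR n + 1) < snd p < INR n + 1))
    by exact (continuous_snd x y _ (open_Ioo _ _ _ H3)).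
  generalize (filter_and _ _ L1 (filter_and _ _ L2 L3)). apply filter_imp.
  by intros p [G1 [G2 G3]].
Qed.

(** The boxes form an increasing open cover of the domain, so a finite subcover of [K] lies in its
    largest member. *)
Lemma compact_exhaustion (K : R * R -> Prop) :
  compact_set K -> (forall p, K p -> dom p) ->
  exists n, forall p, K p -> exhaustion n p.
Proof.
  intros HK Hdom. assert (Ha := gf_pos _ _ _ _ _ _ _ GF).
  destruct (HK (fun U => exists n, U = exhaustion n)) as [l [Hl1 Hl2]].
  - intros U [n ->]. apply open_exhaustion.
  - intros [x y] Kp. assert (HD := Hdom _ Kp). destruct (gf_label x y HD) as [Hs _].
    set (s := psi x y) in *.
    assert (Hmin : 0 < Rmin s (a - s)) by (apply Rmin_glb_lt; lra).
    assert (M1 := Rmin_l s (a - s)). assert (M2 := Rmin_r s (a - s)).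
    (* [n + 1] exceeds both quantities: the first bounds the height, the second makes [a / (n + 3)]
       smaller than the distance of [s] from either end of [(0, a)]. *)
    destruct (nfloor_ex (Rmax (Rabs y) (a / Rmin s (a - s)))) as [n [_ Hn]].
    { apply Rle_trans with (Rabs y); [apply Rabs_pos|apply Rmax_l]. }
    assert (N1 := Rmax_l (Rabs y) (a / Rmin s (a - s))).
    assert (N2 := Rmax_r (Rabs y) (a / Rmin s (a - s))).
    exists (exhaustion n). split; [by exists n|]. split; auto. simpl. fold s.
    assert (Hn0 := pos_INR n).
    assert (Hq : a / (INR n + 3) < Rmin s (a - s)).
    { apply Rmult_lt_reg_r with (INR n + 3); [lra|].
      replace (a / (INR n + 3) * (INR n + 3)) with a by (field; lra).
      apply Rmult_lt_reg_r with (/ Rmin s (a - s)); [by apply Rinv_0_lt_compat|].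
      replace (Rmin s (a - s) * (INR n + 3) * / Rmin s (a - s)) with (INR n + 3)
        by (field; lra). unfold Rdiv in N2. lra. }
    split; [lra|]. apply Rabs_lt_between. lra.
  - assert (HN : exists N, forall U, In U l -> forall p, U p -> exhaustion N p).
    { clear Hl2. induction l as [|V l IH].
      - exists O. by intros U [].
      - destruct IH as [N HN]; [intros U HU; apply Hl1; by right|].
        destruct (Hl1 V) as [m ->]; [by left|]. exists (max N m).
        intros U [<-|HU] p Up.
        + apply (exhaustion_mono m); auto. lia.
        + apply (exhaustion_mono N); [lia|]. by apply (HN U). }
    destruct HN as [N HN]. exists N. intros p Kp. destruct (Hl2 p Kp) as [U [HU Up]].
    by apply (HN U).
Qed.

(** Read through the flow, the box sits in a closed rectangle contained in the open strip
    [0 < s < a], where continuity gives a bound. *)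
Lemma flow_box_bounded (n : nat) (v : R -> R -> R) :
  Ck_on 0 dom v ->
  exists M, 0 < M /\ forall x y, exhaustion n (x, y) -> Rabs (v x y) <= M.
Proof.
  intros Hv. assert (Ha := gf_pos _ _ _ _ _ _ _ GF). assert (Hn := pos_INR n).
  assert (Hd : 0 < a / (INR n + 3)) by (apply Rdiv_lt_0_compat; lra).
  destruct (continuous_2d_bounded (fun s y => v (X s y) y) (a / (INR n + 3))
    (a - a / (INR n + 3)) (- (INR n + 1)) (INR n + 1)) as [M [HM HMb]].
  - intros s y Hs _.
    apply (Ck_on_continuity 0 (ostrip a) (fun s y => v (X s y) y)).
    + apply Ck_on_flow_comp; auto. lia.
    + unfold vstrip. simpl. lra.
  - exists M. split; auto. intros x y [HD [H1 H2]]. simpl in H1, H2.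
    destruct (gf_label x y HD) as [_ Es]. rewrite <- Es at 1. apply HMb; lra.
Qed.

(** A C^4 function [h] approximates [f] in the coordinates (s, y), and [Lap_par w = - h] is solved
    exactly; the residual [Lap_par w + f] is thus [f - h]. *)
Lemma Lap_par_approx (n : nat) (f : R -> R -> R) :
  Ck_on 0 dom f ->
  exists w, Ck_on 4 dom w /\
    (forall x y, exhaustion n (x, y) ->
       Rabs (Lap_par Bx By w x y + f x y) <= / (INR n + 1)) /\
    forall x0, 0 < x0 < a ->
      w x0 y0 = 0 /\ grad_par Bx By w x0 y0 = dy w x0 y0 /\ dy w x0 y0 = 0.
Proof.
  intros Hf. assert (Ha := gf_pos _ _ _ _ _ _ _ GF). assert (Hn := pos_INR n).
  assert (Hd : 0 < a / (INR n + 3)) by (apply Rdiv_lt_0_compat; lra).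
  assert (Hd2 : a / (INR n + 3) <= a / 3).
  { apply Rmult_le_compat_l; [lra|]. apply Rinv_le_contravar; lra. }
  destruct (smooth_approx_strip 4 (a / (INR n + 3)) (a - a / (INR n + 3))
    (fun s y => f (X s y) y)) with (N := INR n + 1) (e := / (INR n + 1))
    as [h [Hh Hhf]].
  - lra.
  - intros s y Hs.
    apply (Ck_on_continuity 0 (ostrip a) (fun s y => f (X s y) y)).
    + apply Ck_on_flow_comp; auto. lia.
    + unfold vstrip. simpl. lra.
  - apply Rinv_0_lt_compat. lra.
  - assert (Hc : Ck_on_interval 4 0 a (fun _ => 0)).
    { intros x Hx j _.
      assert (Hz : forall i t, Derive_n (fun _ => 0) i t = 0).
      { intros [|i] t; [easy|]. apply (Derive_n_const i 0). }
      split.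
      - apply ex_derive_n_const.
      - apply: (continuous_ext (fun _ => 0)); [by intros t; rewrite Hz|].
        apply: continuous_const. }
    destruct (Lap_par_solve (fun _ => 0) (fun _ => 0) (fun s y => - h s y)) as [w [W1 [W2 W3]]];
      auto.
    { apply Ck_on_opp; [apply open_ostrip|]. by apply (Ck_on_sub _ _ plane). }
    exists w. split; [auto|split; auto].
    intros x y [HD [H1 H2]]. simpl in H1, H2. destruct (gf_label x y HD) as [_ Es].
    rewrite W2; auto. rewrite <- Es at 2.
    replace (- h (psi x y) y + f (X (psi x y) y) y) with
      (- (h (psi x y) y - f (X (psi x y) y) y)) by ring.
    rewrite Rabs_Ropp. apply Hhf; lra.
Qed.

Lemma cv_C0loc_exhaustion (u : R -> R -> R -> R) (v : R -> R -> R) :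
  (forall (n : nat) (e : R), 0 < e -> exists d, 0 < d /\
     forall eps x y, 0 < eps < d -> exhaustion n (x, y) ->
       Rabs (u eps x y - v x y) < e) ->
  cv_C0loc dom u v.
Proof.
  intros H K HK Hdom e. destruct (compact_exhaustion K HK Hdom) as [n Hn].
  destruct (H n e (cond_pos e)) as [d [Hd Hcv]].
  exists (mkposreal d Hd). intros eps Heps Hpos x y Kxy. apply Hcv; [|by apply Hn].
  split; [exact Hpos|]. change (Rabs (eps - 0) < d) in Heps.
  rewrite Rminus_0_r in Heps. apply Rabs_lt_between in Heps. lra.
Qed.

Lemma eps_family (P Q : R -> R) (u0 f0 : R -> R -> R) :
  Ck_on 4 dom u0 -> Ck_on 0 dom f0 ->
  (forall x y, dom (x, y) -> Lap_par Bx By u0 x y = 0) ->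
  (forall x0, 0 < x0 < a ->
     u0 x0 y0 = P x0 /\ grad_par Bx By u0 x0 y0 = dy u0 x0 y0 /\ dy u0 x0 y0 = Q x0) ->
  exists ueps feps : R -> R -> R -> R,
    (forall eps, 0 < eps ->
       Ck_on 2 dom (ueps eps) /\ Ck_on 2 dom (feps eps) /\
       (forall x y, dom (x, y) ->
          - (1 / eps) * Lap_par Bx By (ueps eps) x y - Lap_perp Bx By (ueps eps) x y
          = feps eps x y) /\
       forall x0, 0 < x0 < a ->
         ueps eps x0 y0 = P x0 /\
         grad_par Bx By (ueps eps) x0 y0 = dy (ueps eps) x0 y0 /\
         dy (ueps eps) x0 y0 = Q x0) /\
    cv_C0loc dom ueps u0 /\ cv_C0loc dom feps f0.
Proof.
  intros Hu0 Hf0 HL0 HC0. assert (oD := gf_open_dom).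
  assert (Hperp : forall u, Ck_on 4 dom u -> Ck_on 2 dom (Lap_perp Bx By u)).
  { intros u Hu. apply Lap_perp_smooth; [lia|exact Hu]. }
  set (f := fun x y => f0 x y + Lap_perp Bx By u0 x y).
  assert (Hf : Ck_on 0 dom f).
  { apply Ck_on_plus; [exact oD|exact Hf0|]. apply (Ck_on_le 0 2); [lia|by apply Hperp]. }
  (* Stage [n] records the corrector together with one constant bounding both it and its
     perpendicular Laplacian on the box. The growth of these constants in [n] is uncontrolled, which
     is what [diagonal_index] compensates. *)
  assert (Hseq : forall n, exists wM : (R -> R -> R) * R,
    Ck_on 4 dom (fst wM) /\
    (forall x y, exhaustion n (x, y) ->
       Rabs (Lap_par Bx By (fst wM) x y + f x y) <= / (INR n + 1)) /\
    (forall x0, 0 < x0 < a ->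
      fst wM x0 y0 = 0 /\ dy (fst wM) x0 y0 = 0) /\
    0 < snd wM /\
    (forall x y, exhaustion n (x, y) -> Rabs (fst wM x y) <= snd wM /\
       Rabs (Lap_perp Bx By (fst wM) x y) <= snd wM)).
  { intros n. destruct (Lap_par_approx n f Hf) as [w [W1 [W2 W3]]].
    destruct (flow_box_bounded n w) as [M1 [HM1 B1]].
    { apply (Ck_on_le 0 4); [lia|exact W1]. }
    destruct (flow_box_bounded n (Lap_perp Bx By w)) as [M2 [HM2 B2]].
    { apply (Ck_on_le 0 2); [lia|by apply Hperp]. }
    exists (w, Rmax M1 M2). simpl. split; [exact W1|split; [exact W2|split; [|split]]].
    - intros x0 H0. destruct (W3 x0 H0) as [E1 [_ E2]]. by split.
    - apply Rlt_le_trans with M1; [exact HM1|apply Rmax_l].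
    - intros x y Hxy. split.
      + apply Rle_trans with M1; [by apply B1|apply Rmax_l].
      + apply Rle_trans with M2; [by apply B2|apply Rmax_r]. }
  (* Countable choice turns the existence at each stage into a sequence. *)
  set (W := fun n => proj1_sig (constructive_indefinite_description _ (Hseq n))).
  assert (HW : forall n, _) by exact (fun n =>
    proj2_sig (constructive_indefinite_description _ (Hseq n))).
  cbv beta in HW. change (fun n => proj1_sig (constructive_indefinite_description _ (Hseq n)))
    with W in HW.
  set (w := fun n => fst (W n)). set (M := fun n => snd (W n)).
  destruct (diagonal_index M) as [nu Hnu].
  { intros n. apply (HW n). }
  assert (Hw4 : forall n, Ck_on 4 dom (w n)) by (intros n; apply (HW n)).
  assert (Hw2 : forall n, Ck_on 2 dom (w n)) by (intros n; apply (Ck_on_le 2 4); [lia|apply Hw4]).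
  assert (Hu2 : Ck_on 2 dom u0) by (apply (Ck_on_le 2 4); [lia|exact Hu0]).
  set (ue := fun eps x y => u0 x y + eps * w (nu eps) x y).
  assert (Hue : forall eps, Ck_on 4 dom (ue eps)).
  { intros eps. apply Ck_on_plus_scal; [exact oD|exact Hu0|apply Hw4]. }
  set (fe := fun eps x y => - (1 / eps) * Lap_par Bx By (ue eps) x y
                            - Lap_perp Bx By (ue eps) x y).
  exists ue, fe. split; [|split].
  - intros eps Heps. split; [|split; [|split]].
    + apply (Ck_on_le 2 4); [lia|apply Hue].
    + apply Ck_on_minus; [exact oD| |by apply Hperp].
      apply Ck_on_mult; [exact oD|by apply Ck_on_const|].
      apply Lap_par_smooth; [lia|apply Hue].
    + reflexivity.
    + intros x0 H0.
      destruct (gf_axis_dom x0 H0) as [HD [_ [_ [E3 [E4 _]]]]].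
      destruct (HW (nu eps)) as [_ [_ [Hz _]]]. destruct (Hz x0 H0) as [Z1 Z2].
      destruct (HC0 x0 H0) as [C1 [_ C2]].
      split; [|split].
      * unfold ue, w. rewrite C1 Z1. ring.
      * unfold grad_par. rewrite E3 E4. ring.
      * unfold ue. rewrite (dy_plus_scal dom u0 (w (nu eps)) eps x0 y0
          (Ck_on_le 1 2 _ _ ltac:(lia) Hu2) (Ck_on_le 1 2 _ _ ltac:(lia) (Hw2 _)) HD).
        unfold w. rewrite C2 Z2. ring.
  - apply cv_C0loc_exhaustion. intros n e He.
    (* [1 / (k + 1) < e]. Asking for an index of at least [max n k] secures both this tolerance and
       the inclusion of the box [n] in the box where the bounds hold. *)
    destruct (nfloor_ex (/ e)) as [k [_ Hk]].
    { left. by apply Rinv_0_lt_compat. }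
    destruct (Hnu (max n k)) as [d [Hd HN]]. exists d. split; [exact Hd|].
    intros eps x y Heps Hxy. destruct (HN eps Heps) as [N1 N2].
    apply (exhaustion_mono n (nu eps)) in Hxy; [|lia].
    destruct (HW (nu eps)) as [_ [_ [_ [_ HB]]]]. destruct (HB x y Hxy) as [B1 _].
    unfold ue. rewrite Rplus_minus_l Rabs_mult (Rabs_pos_eq eps); [|lra].
    apply Rle_lt_trans with (/ (INR (max n k) + 1)).
    + eapply Rle_trans; [|exact N2]. apply Rmult_le_compat_l; [lra|exact B1].
    + rewrite <- (Rinv_inv e). assert (Hi := Rinv_0_lt_compat e He).
      assert (INR k <= INR (max n k)) by (apply le_INR; lia).
      apply Rinv_lt_contravar; [apply Rmult_lt_0_compat|]; lra.
  - apply cv_C0loc_exhaustion. intros n e He.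
    destruct (nfloor_ex (/ (e / 2))) as [k [_ Hk]].
    { left. apply Rinv_0_lt_compat. lra. }
    destruct (Hnu (max n k)) as [d [Hd HN]]. exists d. split; [exact Hd|].
    intros eps x y Heps Hxy. destruct (HN eps Heps) as [N1 N2].
    apply (exhaustion_mono n (nu eps)) in Hxy; [|lia].
    destruct (HW (nu eps)) as [_ [HA [_ [_ HB]]]]. destruct (HB x y Hxy) as [_ B2].
    assert (HD : dom (x, y)) by apply Hxy.
    assert (Elim : Rabs (Lap_par Bx By (w (nu eps)) x y + f x y) <= / (INR (nu eps) + 1))
      by exact (HA x y Hxy).
    assert (Hkk : / (INR (max n k) + 1) < e / 2).
    { rewrite <- (Rinv_inv (e / 2)).
      assert (Hi : 0 < / (e / 2)) by (apply Rinv_0_lt_compat; lra).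
      assert (INR k <= INR (max n k)) by (apply le_INR; lia).
      apply Rinv_lt_contravar; [apply Rmult_lt_0_compat|]; lra. }
    assert (Hnn : / (INR (nu eps) + 1) <= / (INR (max n k) + 1)).
    { assert (INR (max n k) <= INR (nu eps)) by (by apply le_INR).
      assert (Hp := pos_INR (max n k)). apply Rinv_le_contravar; lra. }
    (* As [Lap_par u0 = 0], the singular factor [1 / eps] meets only [eps * Lap_par w] and cancels;
       the term [Lap_perp u0] is the one built into [f]. *)
    assert (Efe : fe eps x y - f0 x y =
      - (Lap_par Bx By (w (nu eps)) x y + f x y) - eps * Lap_perp Bx By (w (nu eps)) x y).
    { unfold fe, f, Lap_perp, ue.
      rewrite (Lap_par_plus_scal u0 (w (nu eps)) eps x y Hu2 (Hw2 _) HD).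
      rewrite (Lap_plus_scal u0 (w (nu eps)) eps x y Hu2 (Hw2 _) HD).
      rewrite (HL0 x y HD). field. lra. }
    rewrite Efe. eapply Rle_lt_trans; [apply Rabs_triang|].
    rewrite !Rabs_Ropp Rabs_mult (Rabs_pos_eq eps); [|lra].
    assert (E2 : eps * Rabs (Lap_perp Bx By (w (nu eps)) x y) <= eps * M (nu eps)).
    { apply Rmult_le_compat_l; [lra|exact B2]. }
    lra.
Qed.

End GraphField.

(** * Trajectories of the normalized field *)

(** [T] is the supremum of the times up to which [f] has stayed below [c]; were [f T < c],
    continuity would extend that interval beyond [T]. *)
Lemma first_hit (f : R -> R) (c t1 : R) :
  (forall t, continuous f t) -> f 0 < c -> 0 <= t1 -> c <= f t1 ->
  exists T, 0 < T <= t1 /\ c <= f T /\ forall t, 0 <= t < T -> f t < c.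
Proof.
  intros Hf H0 Ht1 H1.
  set (E := fun t => 0 <= t <= t1 /\ forall u, 0 <= u <= t -> f u < c).
  assert (E0 : E 0).
  { split; [lra|]. intros u Hu. assert (Eu : u = 0) by lra. by rewrite Eu. }
  destruct (completeness E) as [T [HT1 HT2]].
  { exists t1. intros t [Ht _]. lra. }
  { exists 0. exact E0. }
  assert (HT0 : 0 <= T) by exact (HT1 0 E0).
  assert (HTt : T <= t1) by (apply HT2; intros t [Ht _]; lra).
  assert (Hlt : forall t, 0 <= t < T -> f t < c).
  { intros t Ht. destruct (Rlt_dec (f t) c) as [H|H]; auto. exfalso.
    assert (T <= t); [|lra]. apply HT2. intros e [He1 He2].
    destruct (Rle_dec e t); auto. exfalso. apply H, He2. lra. }
  assert (HfT : c <= f T).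
  { destruct (Rle_dec c (f T)) as [H|H]; auto. exfalso.
    destruct (proj1 (filterlim_locally _ _) (Hf T) (mkposreal (c - f T) ltac:(lra))) as [r Hr].
    assert (Hr0 := cond_pos r).
    assert (Hnear : forall u, T <= u < T + r -> f u < c).
    { intros u Hu. assert (Hb : ball T r u) by (apply Rabs_lt_between'; lra).
      assert (H2 := Hr u Hb). change (Rabs (f u - f T) < c - f T) in H2.
      apply Rabs_lt_between in H2. lra. }
    assert (HTm : T < Rmin t1 (T + r / 2)).
    { apply Rmin_glb_lt; [|lra]. destruct HTt as [Hlt1|Heq]; auto. subst T. lra. }
    assert (M1 := Rmin_l t1 (T + r / 2)). assert (M2 := Rmin_r t1 (T + r / 2)).
    assert (E (Rmin t1 (T + r / 2))).
    { split; [lra|]. intros u Hu. destruct (Rlt_dec u T); [apply Hlt; lra|].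
      apply Hnear. lra. }
    assert (H3 := HT1 _ H2). lra. }
  exists T. split; [|split]; auto. split; auto.
  destruct HT0 as [H|H]; auto. rewrite <- H in HfT. lra.
Qed.

(** The signs of the field are known only in regions that the trajectory must first be shown to keep
    to. As long as [x < c], the height cannot drop below [y0], then [x] cannot become negative, then
    [x] cannot exceed [s0]; since [s0 < c], the level [c] is never reached. *)
Lemma trajectory_forward (bX bY : R -> R -> R) (x y : R -> R) (eta c s0 y0 : R) :
  0 <= s0 < c ->
  (forall t, - eta < x t) ->
  (forall t, is_derive x t (bX (x t) (y t))) ->
  (forall t, is_derive y t (bY (x t) (y t))) ->
  x 0 = s0 -> y 0 = y0 ->
  (forall u v, 0 <= u < c -> y0 <= v -> bX u v <= 0) ->
  (forall u v, - eta < u < 0 -> y0 <= v -> 0 <= bX u v) ->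
  (forall u v, - eta < u < c -> 0 < bY u v) ->
  (forall u v, - eta < u < c -> bX u v ^ 2 + bY u v ^ 2 = 1) ->
  forall t, 0 <= t -> 0 <= x t <= s0 /\ y0 - s0 + t <= y t.
Proof.
  intros Hs0 Hlow Hx Hy Hx0 Hy0 S1 S2 S3 S4.
  assert (Cx : forall t, continuous x t).
  { intros t. apply: ex_derive_continuous. eexists. apply Hx. }
  assert (Mx : forall a b, a < b -> exists z, x b - x a = bX (x z) (y z) * (b - a) /\ a < z < b).
  { intros a b Hab. apply MVT_cor2 with (f' := fun z => bX (x z) (y z)); auto.
    intros z _. apply is_derive_Reals, Hx. }
  assert (My : forall a b, a < b -> exists z, y b - y a = bY (x z) (y z) * (b - a) /\ a < z < b).
  { intros a b Hab. apply MVT_cor2 with (f' := fun z => bY (x z) (y z)); auto.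
    intros z _. apply is_derive_Reals, Hy. }
  assert (HY : forall T, (forall t, 0 <= t < T -> x t < c) -> forall t, 0 <= t <= T -> y0 <= y t).
  { intros T HT t [[Ht|Ht] HtT]; [|rewrite <- Ht; lra].
    destruct (My 0 t Ht) as [z [Ez Hz]]. rewrite Hy0 in Ez.
    assert (H : 0 < bY (x z) (y z)) by (apply S3; split; [auto|apply HT; lra]).
    assert (0 < bY (x z) (y z) * (t - 0)) by (apply Rmult_lt_0_compat; lra). lra. }
  assert (HP : forall T, (forall t, 0 <= t < T -> x t < c) -> forall t, 0 <= t < T -> 0 <= x t).
  { intros T HT t1 Ht1. destruct (Rle_dec 0 (x t1)) as [H|H]; auto. exfalso.
    (* In reversed time, the first hit of level 0 is the last time before [t1] with [x >= 0]. After
       it the trajectory runs at negative [x], where the field pushes it to the right, so [x t1]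
       could not be negative. *)
    destruct (first_hit (fun t => x (t1 - t)) 0 t1) as [r [Hr1 [Hr2 Hr3]]].
    - intros t. apply (continuous_comp (fun t => t1 - t) x); [|apply Cx].
      apply: continuous_minus; [apply: continuous_const|apply: continuous_id].
    - rewrite Rminus_0_r. lra.
    - lra.
    - rewrite Rminus_eq_0. lra.
    - destruct (Mx (t1 - r) t1 ltac:(lra)) as [z [Ez Hz]].
      assert (Hxz : x z < 0).
      { replace z with (t1 - (t1 - z)) by ring. apply Hr3. lra. }
      assert (Hb : 0 <= bX (x z) (y z)).
      { apply S2; [split; auto|]. apply (HY T); auto. lra. }
      assert (0 <= bX (x z) (y z) * (t1 - (t1 - r))) by (apply Rmult_le_pos; lra). lra. }
  assert (HU : forall T, (forall t, 0 <= t < T -> x t < c) -> forall t, 0 <= t <= T -> x t <= s0).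
  { intros T HT t [[Ht|Ht] HtT]; [|rewrite <- Ht; lra].
    destruct (Mx 0 t Ht) as [z [Ez Hz]]. rewrite Hx0 in Ez.
    assert (H : bX (x z) (y z) <= 0).
    { apply S1.
      - split; [apply (HP T); auto; lra|apply HT; lra].
      - apply (HY T); auto. lra. }
    assert (0 <= - bX (x z) (y z) * (t - 0)) by (apply Rmult_le_pos; lra). lra. }
  assert (Hlt : forall t, 0 <= t -> x t < c).
  { intros t1 Ht1. destruct (Rlt_dec (x t1) c) as [H|H]; auto. exfalso.
    destruct (first_hit x c t1) as [T [H1 [H2 H3]]]; auto; try lra.
    assert (H4 := HU T H3 T). lra. }
  intros t Ht.
  assert (HT : forall u, 0 <= u < t + 1 -> x u < c) by (intros u Hu; apply Hlt; lra).
  assert (R1 := HP (t + 1) HT). assert (R2 := HU (t + 1) HT). assert (R3 := HY (t + 1) HT).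
  assert (R1t := R1 t ltac:(lra)). assert (R2t := R2 t ltac:(lra)).
  split; [lra|]. destruct Ht as [Ht|Ht]; [|rewrite <- Ht; lra].
  (* Neither [y] alone nor [x] alone has a speed bounded from below, but [y - x] does: the field is
     a unit vector with [bX <= 0 < bY]. *)
  destruct (MVT_cor2 (fun u => y u - x u) (fun u => bY (x u) (y u) - bX (x u) (y u)) 0 t Ht)
    as [z [Ez Hz]].
  { intros z _. apply is_derive_Reals. apply: is_derive_minus; auto. }
  rewrite Hx0 Hy0 in Ez.
  assert (Z1 := R1 z ltac:(lra)). assert (Z2 := R3 z ltac:(lra)). assert (Z3 := HT z ltac:(lra)).
  assert (B1 := S1 (x z) (y z) ltac:(lra) Z2).
  assert (B2 := S3 (x z) (y z) (conj (Hlow z) Z3)).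
  assert (B3 := S4 (x z) (y z) (conj (Hlow z) Z3)).
  set (p := bX (x z) (y z)) in *. set (q := bY (x z) (y z)) in *.
  assert (B4 : 1 <= q - p).
  (* The square of [q - p] is [1 - 2 p q], which is at least 1 since [p <= 0 < q]. *)
  { apply Rsqr_incr_0_var; [|lra]. unfold Rsqr.
    assert (0 <= q * - p) by (apply Rmult_le_pos; lra). lra. }
  assert (1 * t <= (q - p) * t) by (apply Rmult_le_compat_r; lra). lra.
Qed.

(** The past is reduced to the future: reversing time and reflecting the height about [y0] gives a
    trajectory of the field [(- bX, bY)] taken at the reflected point, which satisfies the same sign
    conditions. *)
Lemma trajectory_global (bX bY : R -> R -> R) (x y : R -> R) (eta c s0 y0 : R) :
  0 <= s0 < c ->
  (forall t, - eta < x t) ->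
  (forall t, is_derive x t (bX (x t) (y t))) ->
  (forall t, is_derive y t (bY (x t) (y t))) ->
  x 0 = s0 -> y 0 = y0 ->
  (forall u v, 0 <= u < c -> (y0 <= v -> bX u v <= 0) /\ (v <= y0 -> 0 <= bX u v)) ->
  (forall u v, - eta < u < 0 -> (y0 <= v -> 0 <= bX u v) /\ (v <= y0 -> bX u v <= 0)) ->
  (forall u v, - eta < u < c -> 0 < bY u v) ->
  (forall u v, - eta < u < c -> bX u v ^ 2 + bY u v ^ 2 = 1) ->
  (forall t, 0 <= x t <= s0) /\
  (forall t, 0 <= t -> y0 - s0 + t <= y t) /\ (forall t, t <= 0 -> y t <= y0 + s0 + t).
Proof.
  intros Hs0 Hlow Hx Hy Hx0 Hy0 S1 S2 S3 S4.
  assert (Fw := trajectory_forward bX bY x y eta c s0 y0 Hs0 Hlow Hx Hy Hx0 Hy0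
    (fun u v H => proj1 (S1 u v H)) (fun u v H => proj1 (S2 u v H)) S3 S4).
  assert (Bw : forall t, 0 <= t -> 0 <= x (- t) <= s0 /\ y0 - s0 + t <= 2 * y0 - y (- t)).
  { assert (Dn : forall t, is_derive (fun t => - t) t (-1)).
    { intros t. apply: is_derive_opp. apply: is_derive_id. }
    apply (trajectory_forward (fun u v => - bX u (2 * y0 - v)) (fun u v => bY u (2 * y0 - v))
      (fun t => x (- t)) (fun t => 2 * y0 - y (- t)) eta c s0 y0); auto.
    - intros t. replace (2 * y0 - (2 * y0 - y (- t))) with (y (- t)) by ring.
      replace (- bX (x (- t)) (y (- t))) with (-1 * bX (x (- t)) (y (- t))) by ring.
      apply: (is_derive_comp x (fun t => - t)); auto.
    - intros t. replace (2 * y0 - (2 * y0 - y (- t))) with (y (- t)) by ring.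
      replace (bY (x (- t)) (y (- t))) with (0 - -1 * bY (x (- t)) (y (- t))) by ring.
      apply: is_derive_minus; [apply: is_derive_const|].
      apply: (is_derive_comp y (fun t => - t)); auto.
    - by rewrite Ropp_0.
    - rewrite Ropp_0 Hy0. ring.
    - intros u v Hu Hv. destruct (S1 u (2 * y0 - v) Hu) as [_ H]. specialize (H ltac:(lra)). lra.
    - intros u v Hu Hv. destruct (S2 u (2 * y0 - v) Hu) as [_ H]. specialize (H ltac:(lra)). lra.
    - intros u v Hu. rewrite <- (S4 u (2 * y0 - v) Hu). ring. }
  split; [|split].
  - intros t. destruct (Rle_dec 0 t) as [H|H]; [by apply Fw|].
    rewrite <- (Ropp_involutive t). apply Bw. lra.
  - intros t Ht. by apply Fw.
  - intros t Ht. destruct (Bw (- t)) as [_ H]; [lra|]. rewrite Ropp_involutive in H. lra.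
Qed.

Lemma increasing_of_derive (y y' : R -> R) (s t : R) :
  (forall t, is_derive y t (y' t)) -> (forall t, 0 < y' t) -> s < t -> y s < y t.
Proof.
  intros Hy Hd Hst. destruct (MVT_cor2 y y' s t Hst) as [z [Ez _]].
  { intros z _. apply is_derive_Reals, Hy. }
  assert (0 < y' z * (t - s)) by (apply Rmult_lt_0_compat; [auto|lra]). lra.
Qed.

(** Strict monotonicity of [y] makes [tau] continuous, after which implicit differentiation applies
    with a dummy second variable. *)
Lemma is_derive_inverse (y y' tau : R -> R) (v : R) :
  (forall t, is_derive y t (y' t)) -> (forall t, 0 < y' t) ->
  (forall v, y (tau v) = v) -> is_derive tau v (/ y' (tau v)).
Proof.
  intros Hy Hd Ht.
  assert (Hinc := fun s t => increasing_of_derive y y' s t Hy Hd).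
  assert (Hc : continuous tau v).
  { apply filterlim_locally. intros e. assert (He := cond_pos e).
    assert (L : y (tau v - e) < v < y (tau v + e)).
    { rewrite <- (Ht v) at 2 3. split; apply Hinc; lra. }
    generalize (open_Ioo _ _ _ L). apply filter_imp. intros u [Hu1 Hu2].
    apply Rabs_lt_between'. rewrite <- (Ht u) in Hu1, Hu2.
    split.
    - destruct (Rlt_dec (tau v - e) (tau u)) as [H|H]; auto. exfalso.
      destruct (Rle_lt_or_eq_dec (tau u) (tau v - e)) as [H'|H']; [lra| |].
      + assert (H2 := Hinc _ _ H'). lra.
      + rewrite H' in Hu1. lra.
    - destruct (Rlt_dec (tau u) (tau v + e)) as [H|H]; auto. exfalso.
      destruct (Rle_lt_or_eq_dec (tau v + e) (tau u)) as [H'|H']; [lra| |].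
      + assert (H2 := Hinc _ _ H'). lra.
      + rewrite H' in Hu2. lra. }
  assert (Hdn := Hd (tau v)).
  replace (/ y' (tau v)) with ((1 - 0 * 0) / y' (tau v)) by (field; lra).
  apply (is_derive_implicit (fun s _ => y s) tau (fun _ => 0) (fun u => u)); auto.
  - apply differentiable_pt_lim_proj1_0. apply is_derive_Reals, Hy.
  - lra.
  - apply: is_derive_const.
  - apply: is_derive_id.
  - by apply filter_forall.
Qed.

Lemma sign_change_zero (h : R -> R) (y0 : R) :
  continuous h y0 -> (forall y, y < y0 -> 0 <= h y) -> (forall y, y0 < y -> h y <= 0) ->
  h y0 = 0.
Proof.
  intros Hc Hl Hr. destruct (Req_dec (h y0) 0) as [H|H]; auto. exfalso.
  assert (Hp := Rabs_pos_lt _ H).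
  destruct (proj1 (filterlim_locally _ _) Hc (mkposreal _ Hp)) as [r Hrr].
  assert (Hr0 := cond_pos r).
  assert (B1 : ball y0 r (y0 - r / 2)) by (apply Rabs_lt_between'; lra).
  assert (B2 : ball y0 r (y0 + r / 2)) by (apply Rabs_lt_between'; lra).
  assert (C1 := Hrr _ B1). assert (C2 := Hrr _ B2).
  change (Rabs (h (y0 - r / 2) - h y0) < Rabs (h y0)) in C1.
  change (Rabs (h (y0 + r / 2) - h y0) < Rabs (h y0)) in C2.
  assert (H1 := Hl (y0 - r / 2) ltac:(lra)). assert (H2 := Hr (y0 + r / 2) ltac:(lra)).
  revert C1 C2. unfold Rabs. repeat destruct Rcase_abs; lra.
Qed.

(** * From the standing conditions to a graph field *)

Section Flow.
Variables (Bx By : R -> R -> R) (eta d L : R) (Phi : R -> R * R -> R * R) (alpha : R).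
Hypothesis CBx : Ck_on 5 (fun _ => True) Bx.
Hypothesis CBy : Ck_on 5 (fun _ => True) By.
Hypothesis ST : standing Bx By eta d L.
Hypothesis FW : is_flow Bx By eta d L Phi.
Hypothesis Ha : 0 < alpha < d / 2.

(** The side of the centre [S] on which [By > 0]. It extends beyond the wall [x = 0], so it is an
    open neighbourhood of the closed interval [[0, alpha]]. *)
Definition left_half (x : R) : Prop := - eta < x < d / 2.

Lemma norm_pos (x y : R) : left_half x -> 0 < normB Bx By x y.
Proof.
  intros Hx. apply sqrt_lt_R0.
  assert (H := By_left _ _ _ _ _ ST x y Hx). assert (H1 := pow2_ge_0 (Bx x y)).
  assert (H2 : 0 < By x y ^ 2) by by apply pow_lt. lra.
Qed.

Lemma open_left_half : open (vstrip left_half).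
Proof. apply open_vstrip, open_Ioo. Qed.

Lemma Ck_on_left_half (f : R -> R -> R) :
  Ck_on 5 (fun _ => True) f -> Ck_on 5 (vstrip left_half) f.
Proof. by apply Ck_on_sub. Qed.

Lemma norm_smooth : Ck_on 5 (vstrip left_half) (normB Bx By).
Proof.
  assert (oJ := open_left_half).
  assert (Hsq : forall f, Ck_on 5 (fun _ => True) f ->
            Ck_on 5 (vstrip left_half) (fun x y => f x y ^ 2)).
  { intros f Hf. apply Ck_on_left_half in Hf. simpl.
    apply Ck_on_mult; [exact oJ|exact Hf|].
    apply Ck_on_mult; [exact oJ|exact Hf|by apply Ck_on_const]. }
  apply (Ck_on_sqrt 5 _ (fun x y => Bx x y ^ 2 + By x y ^ 2)); [exact oJ| |].
  - intros x y Hx. assert (H := By_left _ _ _ _ _ ST x y Hx).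
    assert (H1 := pow2_ge_0 (Bx x y)).
    assert (H2 : 0 < By x y ^ 2) by by apply pow_lt. lra.
  - apply Ck_on_plus; [exact oJ|by apply Hsq|by apply Hsq].
Qed.

(** Off the walls [Bx] has opposite signs below and above the height [L / 2], so continuity forces a
    zero there; on the wall [x = 0] it vanishes by assumption. *)
Lemma Bx_axis (x : R) : left_half x -> Bx x (L / 2) = 0.
Proof.
  intros [Hx1 Hx2]. assert (Hd := d_pos _ _ _ _ _ ST).
  assert (Hc : forall y, continuous (Bx x) y).
  { intros y. apply continuity_2d_pt_section. by apply (Ck_on_continuity 5 (fun _ => True)). }
  destruct (Rtotal_order x 0) as [H|[H|H]].
  - apply Ropp_eq_reg. rewrite Ropp_0.
    apply (sign_change_zero (fun y => - Bx x y)).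
    + apply: continuous_opp. apply Hc.
    + intros y Hy. assert (B := Bx_left_below _ _ _ _ _ ST x y ltac:(lra) Hy). lra.
    + intros y Hy. assert (B := Bx_left_above _ _ _ _ _ ST x y ltac:(lra) Hy). lra.
  - rewrite H. apply (Bx_walls _ _ _ _ _ ST).
  - apply (sign_change_zero (Bx x)); [apply Hc| |].
    + intros y Hy. assert (B := Bx_mid_below _ _ _ _ _ ST x y ltac:(lra) Hy). lra.
    + intros y Hy. assert (B := Bx_mid_above _ _ _ _ _ ST x y ltac:(lra) Hy). lra.
Qed.

Lemma b_unit (x y : R) :
  left_half x -> bx Bx By x y ^ 2 + by_ Bx By x y ^ 2 = 1.
Proof.
  intros Hx. assert (Hn := norm_pos x y Hx). unfold bx, by_.
  assert (Hs : normB Bx By x y * normB Bx By x y = Bx x y ^ 2 + By x y ^ 2).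
  { apply sqrt_sqrt. assert (H1 := pow2_ge_0 (Bx x y)). assert (H2 := pow2_ge_0 (By x y)). lra. }
  replace ((Bx x y / normB Bx By x y) ^ 2 + (By x y / normB Bx By x y) ^ 2) with
    ((Bx x y ^ 2 + By x y ^ 2) / (normB Bx By x y * normB Bx By x y)) by (field; lra).
  rewrite <- Hs. field. lra.
Qed.

Lemma by_pos (x y : R) : left_half x -> 0 < by_ Bx By x y.
Proof.
  intros Hx. apply Rdiv_lt_0_compat; [by apply (By_left _ _ _ _ _ ST)|by apply norm_pos].
Qed.

Lemma bx_nonneg (x y : R) : left_half x -> 0 <= Bx x y -> 0 <= bx Bx By x y.
Proof. intros Hx H. apply Rdiv_le_0_compat; auto. by apply norm_pos. Qed.

Lemma bx_nonpos (x y : R) : left_half x -> Bx x y <= 0 -> bx Bx By x y <= 0.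
Proof.
  intros Hx H. assert (Hn := norm_pos x y Hx). unfold bx.
  assert (0 <= - Bx x y / normB Bx By x y) by (apply Rdiv_le_0_compat; lra).
  unfold Rdiv in *. lra.
Qed.

Lemma bx_sign_right (x y : R) : 0 <= x < d / 2 ->
  (L / 2 <= y -> bx Bx By x y <= 0) /\ (y <= L / 2 -> 0 <= bx Bx By x y).
Proof.
  intros Hx. assert (He := eta_pos _ _ _ _ _ ST). assert (Hd := d_pos _ _ _ _ _ ST).
  assert (HJ : left_half x) by (unfold left_half; lra).
  assert (H0 := Bx_axis x HJ).
  split; intros [Hy|Hy].
  - apply bx_nonpos; auto. destruct (proj1 Hx) as [H|H].
    + assert (B := Bx_mid_above _ _ _ _ _ ST x y ltac:(lra) Hy). lra.
    + rewrite <- H. right. apply (Bx_walls _ _ _ _ _ ST).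
  - apply bx_nonpos; auto. rewrite <- Hy. lra.
  - apply bx_nonneg; auto. destruct (proj1 Hx) as [H|H].
    + assert (B := Bx_mid_below _ _ _ _ _ ST x y ltac:(lra) Hy). lra.
    + rewrite <- H. right. symmetry. apply (Bx_walls _ _ _ _ _ ST).
  - apply bx_nonneg; auto. rewrite Hy. lra.
Qed.

Lemma bx_sign_left (x y : R) : - eta < x < 0 ->
  (L / 2 <= y -> 0 <= bx Bx By x y) /\ (y <= L / 2 -> bx Bx By x y <= 0).
Proof.
  intros Hx. assert (Hd := d_pos _ _ _ _ _ ST).
  assert (HJ : left_half x) by (unfold left_half; lra).
  assert (H0 := Bx_axis x HJ).
  split; intros [Hy|Hy].
  - apply bx_nonneg; auto. left. by apply (Bx_left_above _ _ _ _ _ ST).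
  - apply bx_nonneg; auto. rewrite <- Hy. lra.
  - apply bx_nonpos; auto. left. by apply (Bx_left_below _ _ _ _ _ ST).
  - apply bx_nonpos; auto. rewrite Hy. lra.
Qed.

Local Notation px s t := (fst (Phi t (s, L / 2))).
Local Notation py s t := (snd (Phi t (s, L / 2))).

(** The case [s = 0] is included, since [is_flow] covers starting points down to [- eta / 2]; it
    supplies the left edge of the domain. *)
Lemma flow_facts (s : R) : 0 <= s <= alpha ->
  px s 0 = s /\ py s 0 = L / 2 /\
  (forall t, 0 <= px s t <= s) /\
  (forall t, is_derive (fun t => px s t) t (bx Bx By (px s t) (py s t))) /\
  (forall t, is_derive (fun t => py s t) t (by_ Bx By (px s t) (py s t))) /\
  (forall v, exists t, py s t = v).
Proof.
  intros Hs. assert (He := eta_pos _ _ _ _ _ ST).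
  destruct (FW s ltac:(lra)) as [H0 Ht].
  assert (Hx0 : px s 0 = s) by by rewrite H0.
  assert (Hy0 : py s 0 = L / 2) by by rewrite H0.
  assert (Dx : forall t, is_derive (fun t => px s t) t (bx Bx By (px s t) (py s t)))
    by (intros t; apply (Ht t)).
  assert (Dy : forall t, is_derive (fun t => py s t) t (by_ Bx By (px s t) (py s t)))
    by (intros t; apply (Ht t)).
  destruct (trajectory_global (bx Bx By) (by_ Bx By) (fun t => px s t) (fun t => py s t)
    eta (d / 2) s (L / 2)) as [T1 [T2 T3]]; auto.
  - lra.
  - intros t. apply (Ht t).
  - apply bx_sign_right.
  - apply bx_sign_left.
  - apply by_pos.
  - apply b_unit.
  - repeat (split; auto). 
    (* By the linear growth of the height, waiting for the time [|v - L / 2| + s] brings it to at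
       least [L / 2 + |v - L / 2|], and symmetrically in the past, so [v] is bracketed. *)
    intros v. destruct (IVT_gen (fun t => py s t) (- (Rabs (v - L / 2) + s))
      (Rabs (v - L / 2) + s) v) as [t [_ Et]].
    + intros t. apply continuity_pt_filterlim.
      apply (ex_derive_continuous (fun t => py s t)). eexists. apply Dy.
    + assert (Hp := Rabs_pos (v - L / 2)).
      assert (U1 := T2 (Rabs (v - L / 2) + s) ltac:(lra)).
      assert (U2 := T3 (- (Rabs (v - L / 2) + s)) ltac:(lra)).
      assert (Hv : - Rabs (v - L / 2) <= v - L / 2 <= Rabs (v - L / 2)) by (apply Rabs_le_between; lra).
      rewrite Rmin_left; [|lra]. rewrite Rmax_right; lra.
    + by exists t.
Qed.

(** The inverse of the height along the trajectory of [s]. For [0 <= s <= alpha] every height is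
    attained, so the choice is meaningful for all [v]. *)
Definition flow_time (s v : R) : R := epsilon (inhabits 0) (fun t => py s t = v).

Definition flow_graph (s v : R) : R := px s (flow_time s v).

Lemma flow_time_spec (s v : R) : 0 <= s <= alpha -> py s (flow_time s v) = v.
Proof.
  intros Hs. apply (epsilon_spec (inhabits 0) (fun t => py s t = v)).
  by apply flow_facts.
Qed.

Lemma py_inj (s t1 t2 : R) : 0 <= s <= alpha -> py s t1 = py s t2 -> t1 = t2.
Proof.
  intros Hs H. destruct (flow_facts s Hs) as [_ [_ [R1 [_ [Dy _]]]]].
  assert (He := eta_pos _ _ _ _ _ ST).
  assert (Hinc : forall t t', t < t' -> py s t < py s t').
  { intros t t'. apply (increasing_of_derive (fun t => py s t) _ t t' Dy).
    intros z. apply by_pos. assert (R1z := R1 z). unfold left_half. lra. }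
  destruct (Rtotal_order t1 t2) as [H1|[H1|H1]]; auto.
  - assert (H2 := Hinc _ _ H1). lra.
  - assert (H2 := Hinc _ _ H1). lra.
Qed.

(** Time is eliminated by the chain rule: [flow_time] has derivative [1 / by_], and the norm cancels
    in [bx / by_], which leaves the slope [Bx / By]. *)
Lemma flow_graph_scalar_flow :
  scalar_flow left_half (fun x y => Bx x y / By x y) flow_graph (L / 2) alpha.
Proof.
  assert (He := eta_pos _ _ _ _ _ ST).
  assert (Hr : forall s y, 0 <= s <= alpha -> 0 <= flow_graph s y <= s).
  { intros s y Hs. by apply (flow_facts s Hs). }
  split.
  - apply open_Ioo.
  - intros x Hx. unfold left_half. lra.
  - intros s y Hs. assert (H := Hr s y Hs). lra.
  - intros s y Hs. assert (HX := Hr s y Hs).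
    destruct (flow_facts s Hs) as [_ [_ [R1 [Dx [Dy _]]]]].
    assert (HJ : forall t, left_half (px s t)).
    { intros t. assert (R1t := R1 t). unfold left_half. lra. }
    assert (Dt := is_derive_inverse (fun t => py s t) _ (flow_time s) y Dy
      (fun t => by_pos _ _ (HJ t)) (fun v => flow_time_spec s v Hs)).
    simpl in Dt. unfold flow_graph at 1.
    replace (Bx (flow_graph s y) y / By (flow_graph s y) y) with
      (/ by_ Bx By (px s (flow_time s y)) (py s (flow_time s y)) *
       bx Bx By (px s (flow_time s y)) (py s (flow_time s y))).
    + apply: (is_derive_comp (fun t => px s t) (flow_time s)); auto.
    + rewrite (flow_time_spec s y Hs). fold (flow_graph s y).
      assert (HJg := HJ (flow_time s y)). fold (flow_graph s y) in HJg.
      assert (Hn := norm_pos _ y HJg). assert (HB := By_left _ _ _ _ _ ST _ y HJg).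
      unfold bx, by_. field. split; lra.
  - intros s Hs. destruct (flow_facts s Hs) as [Hx0 [Hy0 _]].
    unfold flow_graph. rewrite (py_inj s (flow_time s (L / 2)) 0 Hs); auto.
    rewrite Hy0. by apply flow_time_spec.
  (* The bound [0 <= flow_graph s y <= s] pins the trajectory of [s = 0] to the wall. *)
  - intros y. assert (H := Hr 0 y ltac:(lra)). lra.
Qed.

Lemma flow_graph_field :
  graph_field Bx By left_half (fun x y => Bx x y / By x y) flow_graph (L / 2) alpha.
Proof.
  assert (oJ := open_left_half). assert (HN := norm_smooth).
  assert (CX := Ck_on_left_half _ CBx). assert (CY := Ck_on_left_half _ CBy).
  assert (HNnz : forall x y, vstrip left_half (x, y) -> normB Bx By x y <> 0).
  { intros x y Hx. apply Rgt_not_eq. by apply norm_pos. }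
  split.
  - exact flow_graph_scalar_flow.
  - apply Ha.
  - apply Ck_on_div; [exact oJ| |exact CX|exact CY].
    intros x y Hx. apply Rgt_not_eq. by apply (By_left _ _ _ _ _ ST).
  - by apply Ck_on_div.
  - by apply Ck_on_div.
  - exact by_pos.
  - intros x y Hx. assert (Hn := norm_pos x y Hx). assert (HB := By_left _ _ _ _ _ ST x y Hx).
    unfold bx, by_. field. lra.
  - intros x Hx. assert (H0 := Bx_axis x Hx). assert (HB := By_left _ _ _ _ _ ST x (L / 2) Hx).
    unfold bx, by_, normB. rewrite H0. split; [apply Rmult_0_l|].
    replace (0 ^ 2 + By x (L / 2) ^ 2) with (By x (L / 2) ^ 2) by ring.
    rewrite sqrt_pow2; [|lra]. field. lra.
Qed.

(** The time in [D_alpha] is unique, hence equal to [flow_time], and the bound [x < d / 2] follows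
    from [flow_graph alpha y <= alpha]. Equality as predicates allows rewriting the domain
    everywhere at once. *)
Lemma D_alpha_flow_dom : D_alpha d L Phi alpha = flow_dom flow_graph alpha.
Proof.
  assert (Haa : 0 <= alpha <= alpha) by lra.
  apply functional_extensionality. intros [x y]. apply propositional_extensionality.
  unfold D_alpha, flow_dom. simpl. split.
  - intros [Hx [t [Et Ht]]]. split; [lra|]. unfold flow_graph.
    rewrite (py_inj alpha (flow_time alpha y) t Haa); auto.
    rewrite Et. by apply flow_time_spec.
  - intros [Hx1 Hx2]. split.
    + assert (H := proj1 (proj2 (proj2 (flow_facts alpha Haa))) (flow_time alpha y)).
      unfold flow_graph in Hx2. lra.
    + exists (flow_time alpha y). split; auto. by apply flow_time_spec.
Qed.

End Flow.

Theorem theorem2 :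
  forall (Bx By : R -> R -> R) (eta d L : R) (Phi : R -> R * R -> R * R)
         (alpha : R) (f0 : R -> R -> R) (P Q : R -> R),
  Ck_on 5 (fun _ => True) Bx ->
  Ck_on 5 (fun _ => True) By ->
  standing Bx By eta d L ->
  is_flow Bx By eta d L Phi ->
  0 < alpha < d / 2 ->
  let D := D_alpha d L Phi alpha in
  Ck_on 2 D f0 ->
  Ck_on_interval 4 0 alpha P ->
  Ck_on_interval 4 0 alpha Q ->
  exists u0 : R -> R -> R,
    (Ck_on 2 D u0 /\ limit_problem Bx By L alpha D P Q u0) /\
    (forall v : R -> R -> R,
       Ck_on 2 D v -> limit_problem Bx By L alpha D P Q v ->
       forall x y, D (x, y) -> v x y = u0 x y) /\
    exists ueps feps : R -> R -> R -> R,
      (forall eps, 0 < eps ->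
         Ck_on 2 D (ueps eps) /\ Ck_on 2 D (feps eps) /\
         eps_problem Bx By L alpha D P Q eps (feps eps) (ueps eps)) /\
      cv_C0loc D ueps u0 /\
      cv_C0loc D feps f0.
Proof.
  intros Bx By eta d L Phi alpha f0 P Q CBx CBy ST FW Ha D Hf0 HP HQ.
  assert (GF := flow_graph_field Bx By eta d L Phi alpha CBx CBy ST FW Ha).
  subst D. rewrite (D_alpha_flow_dom Bx By eta d L Phi alpha CBx ST FW Ha) in Hf0 |- *.
  (* The limit [u0] is obtained in class C^4, beyond the C^2 of the statement; [eps_family] relies
     on this to make [feps] of class C^2. *)
  destruct (Lap_par_solve _ _ _ _ _ _ _ GF P Q (fun _ _ => 0) HP HQ) as [u0 [Hu [HL HC]]].
  { apply Ck_on_const, open_ostrip. }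
  assert (Hu2 := Ck_on_le 2 4 _ u0 ltac:(lia) Hu).
  exists u0. split; [|split].
  - split; [exact Hu2|]. split; [exact HL|exact HC].
  - intros v Hv [HvL HvC].
    apply (Lap_par_unique _ _ _ _ _ _ _ GF v u0 Hv Hu2).
    + intros x y HD. rewrite HvL; auto. by rewrite HL.
    + intros x0 H0. destruct (HvC x0 H0) as [V1 [V2 V3]].
      destruct (HC x0 H0) as [C1 [C2 C3]]. split; congruence.
  - destruct (eps_family _ _ _ _ _ _ _ GF P Q u0 f0 Hu (Ck_on_le 0 2 _ f0 ltac:(lia) Hf0) HL HC)
      as [ue [fe [H1 [H2 H3]]]].
    exists ue, fe. split; [|by split].
    intros eps He. destruct (H1 eps He) as [E1 [E2 [E3 E4]]].
    split; [exact E1|]. split; [exact E2|]. split; [exact E3|exact E4].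
Qed.
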